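(* Let $\rho>1$, let $f$ be analytic in the open Bernstein ellipse $E_\rho$ and continuous on $\overline{E_\rho}$, and set $M_\rho=\max_{z\in\overline{E_\rho}}|f(z)|$. For each integer $n\ge1$, let $I_n^\varepsilon f$ be the polynomial of degree at most $n$ interpolating $f$ at distinct nodes $$x_j=\cos\left(\frac{j\pi}{n}+\varepsilon_j\right),\quad j=0,\ldots,n,\qquad \max_{0\le j\le n}|\varepsilon_j|\le\sigma_n,$$ where the $\varepsilon_j\in\mathbb{R}$ may depend on $n$ and $\varepsilon_0=\varepsilon_n=0$. Assume that, for some fixed $\eta$ (independent of $n$), $$n\sigma_n(\log n+1)\le\eta,\qquad 0<\eta<\left(1+\frac2\pi\right)^{-1}.$$ Then $$\|f-I_n^\varepsilon f\|_{L^\infty[-1,1]}\le\left(1+C_\eta\log(en)\right)\frac{2M_\rho}{\rho-1}\rho^{-n},\qquad C_\eta=\frac{1+\frac2\pi}{1-\left(1+\frac2\pi\right)\eta}.$$ In particular, $I_n^\varepsilon f\to f$ uniformly on $[-1,1]$ as $n\to\infty$.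
   Context: $\log$ denotes the natural logarithm. For $\rho>1$, the Bernstein ellipse $E_\rho$ is the open region of the complex plane bounded by the ellipse with foci $\pm1$ that is the image of the circle $|w|=\rho$ under $z=(w+w^{-1})/2$. *)

(* Defs.v *)
From HB Require Import structures.
From mathcomp Require Import all_boot all_order all_algebra.
From mathcomp Require Import complex ring.
From mathcomp Require Import all_classical all_reals all_analysis.

Set Implicit Arguments.
Unset Strict Implicit.
Unset Printing Implicit Defensive.

Import Order.TTheory GRing.Theory Num.Theory.
Import numFieldNormedType.Exports.
Import ComplexField.Normc.

Local Open Scope classical_set_scope.
Local Open Scope ring_scope.
Local Open Scope complex_scope.

(* The library puts the topology and the norm of a numeric field [K] on [K^o],
   hence the type [R[i]^o] of complex numbers; [normc] is the modulus as an
   element of [R] (the norm [`|z|] takes its values in [R[i]]). *)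

Definition analytic_at (R : realType) (f : R[i]^o -> R[i]^o) (z0 : R[i]^o) :=
  exists a : nat -> R[i]^o, \forall z \near z0,
    series (fun k => a k * (z - z0) ^+ k) @ \oo --> f z.

Definition joukowski (R : realType) (w : R[i]^o) : R[i]^o := (w + w^-1) / 2.

(* The region bounded by the ellipse with foci 1 and -1 along which the sum of
   the distances to the foci is [rho + rho^-1]; that this ellipse is the image
   of the circle [normc w = rho] is [ellipse_joukowski]. *)
Definition bernstein_ellipse (R : realType) (rho : R) : set R[i]^o :=
  [set z | normc (z - 1) + normc (z + 1) < rho + rho^-1].

Lemma normc_foci_joukowski (R : realType) (w : R[i]^o) : w != 0 ->
  normc (joukowski w - 1) + normc (joukowski w + 1) = normc w + (normc w)^-1.
Proof.
move=> w0; have nw0 : normc w != 0 by apply: contra w0 => /eqP/eq0_normc ->.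
have w20 : w * 2 != 0 by rewrite mulf_neq0// pnatr_eq0.
have E (s : R[i]) : s ^+ 2 = 1 -> joukowski w + s = (w + s) ^+ 2 / (w * 2).
  by move=> s2; rewrite sqrrD s2 /joukowski; field.
have nw2 : normc (w * 2) = normc w * 2 by rewrite normcM normcMn normc1.
rewrite (E (-1)) ?sqrrN ?expr1n// (E 1) ?expr1n//.
rewrite !normcM !normcV nw2 -mulrDl.
suff -> : normc (w - 1) * normc (w - 1) + normc (w + 1) * normc (w + 1) =
    (normc w ^+ 2 + 1) * 2 by field.
case: w {w0 nw0 w20 nw2 E} => a b.
rewrite -!expr2 /normc /= !sqr_sqrtr ?addr_ge0 ?sqr_ge0//.
by rewrite oppr0 !addr0; ring.
Qed.

Lemma ellipse_joukowski (R : realType) (rho : R) : 1 < rho ->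
  [set z : R[i]^o | normc (z - 1) + normc (z + 1) = rho + rho^-1] =
  [set joukowski w | w in [set w : R[i]^o | normc w = rho]].
Proof.
move=> rho1; have rho0 : 0 < rho by apply: lt_trans rho1.
apply/seteqP; split => z /=; last first.
  move=> [w wrho <-]; rewrite normc_foci_joukowski ?wrho//.
  by apply: contraTneq rho0 => w0; rewrite -wrho w0 normc0 ltxx.
pose w : R[i] := z + sqrtc (z ^+ 2 - 1).
have ww : w * (2 * z - w) = 1.
  have -> : w * (2 * z - w) = z ^+ 2 - sqrtc (z ^+ 2 - 1) ^+ 2 by rewrite /w; ring.
  by rewrite sqr_sqrtc; ring.
have w0 : w != 0 by apply: contra_eq_neq ww => ->; rewrite mul0r eq_sym oner_eq0.
have zV : w^-1 = 2 * z - w by rewrite -[RHS](mulKf w0) ww mulr1.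
have jw : joukowski w = z by rewrite /joukowski zV; field.
have jwV : joukowski w^-1 = z by rewrite /joukowski invrK addrC.
have nw0 : normc w != 0 by apply: contra w0 => /eqP/eq0_normc ->.
move: (normc_foci_joukowski w0); rewrite jw => -> wrho.
have /eqP : (normc w - rho) * (normc w - rho^-1) = 0.
  have -> : (normc w - rho) * (normc w - rho^-1) =
      normc w * (normc w + (normc w)^-1 - (rho + rho^-1)).
    by field; rewrite nw0 gt_eqF.
  by rewrite wrho subrr mulr0.
rewrite mulf_eq0 !subr_eq0 => /orP[] /eqP nw; first by exists w.
by exists w^-1 => //; rewrite normcV nw invrK.
Qed.

Definition max_modulus (R : realType) (f : R[i]^o -> R[i]^o) (A : set R[i]^o) : R :=
  sup [set normc (f z) | z in A].

Definition perturbed_node (R : realType) (eps : nat -> nat -> R) (n j : nat) : R :=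
  cos (j%:R * pi / n%:R + eps n j).

Definition interpolates (R : realType) (f : R[i]^o -> R[i]^o) (x : nat -> R)
    (n : nat) (p : {poly R[i]}) :=
  (size p <= n.+1)%N /\ forall j, (j <= n)%N -> p.[(x j)%:C] = f (x j)%:C.

Lemma interpolates_unique (R : realType) (f : R[i]^o -> R[i]^o) (x : nat -> R)
    (n : nat) (p q : {poly R[i]}) :
  (forall i j, (i <= n)%N -> (j <= n)%N -> i != j -> x i != x j) ->
  interpolates f x n p -> interpolates f x n q -> p = q.
Proof.
move=> xinj [sp hp] [sq hq]; apply/eqP; rewrite -subr_eq0; apply: contraTT sp => pq0.
pose s := [seq (x j)%:C | j <- iota 0 n.+1].
have us : uniq s.
  rewrite map_inj_in_uniq ?iota_uniq// => i j; rewrite !mem_iota !ltnS /= => ni nj [].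
  by move=> xij; apply: contraTeq isT => /(xinj _ _ ni nj); rewrite xij eqxx.
have rs : all (root (p - q)) s.
  apply/allP => _ /mapP[j + ->]; rewrite mem_iota ltnS /= => nj.
  by rewrite /root hornerD hornerN hp// hq// subrr.
have := max_poly_roots pq0 rs us; rewrite size_map size_iota => /leq_trans.
move=> /(_ _ (size_polyD _ _)); rewrite size_polyN leq_max.
by move=> /orP[]; rewrite ltnNge// sq.
Qed.

Definition Linf_norm (R : realType) (g : R -> R[i]^o) : \bar R :=
  Lnorm (mrestr (@lebesgue_measure R) (measurable_itv `[(-1)%R, 1%R])) +oo%E
    (fun x => (normc (g x))%:E).

(* Main.v *)
(** For [x] in [[-1, 1]] and [1 < r < rho], put [u = exp(i acos x)] and
    [P(w) = (w^2 - 1) / ((w - u) (w - 1/u)) = 1 + 2 sum_k T_k(x) w^-k].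
    The function [G(w) = (f(J w) - f x) P(w)], with [J w = (w + 1/w) / 2], extends
    holomorphically to [1 <= |w| <= r] and satisfies [G(1/w) = - G(w)], so its mean
    over the [N]-th roots of unity vanishes.  Cauchy's theorem is replaced by a discrete
    form: the means of [G] over the regular [N]-gons of radius [1] and [r] have
    difference tending to [0], because radial and angular increments of [G] are nearly
    proportional.  Hence truncating [P] after [T_n] in the mean of [f(J w) P(w)] gives
    polynomials of degree [n] that approximate [f] up to [2 M r^-n / (r - 1)], plus an
    error vanishing as [N] grows.

    The Lebesgue constant of the unperturbed nodes is bounded by
    [Lambda = (1 + 2/pi) (1 + log n)] through the interpolation formula with kernel
    [(u + z^k) / (u - z^k)], [z = exp(i pi/n)].  By Bernstein's inequality (from Riesz's
    interpolation formula for the derivative) a polynomial of sup norm [L] changes by at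
    most [n sigma L] between a node and its perturbation, whence
    [L <= Lambda (E + n sigma L)] when its values at the perturbed nodes are bounded
    by [E].  Apply this to the interpolant minus the approximating polynomial, and let
    [r] tend to [rho]. *)

Require Import Defs.
From HB Require Import structures.
From mathcomp Require Import all_boot all_order all_algebra.
From mathcomp Require Import complex ring lra zify.
From mathcomp Require Import all_classical all_reals all_analysis ess_sup_inf.
Import Order.TTheory GRing.Theory Num.Theory.
Import numFieldNormedType.Exports.
Import ComplexField.Normc.
Set Implicit Arguments.
Unset Strict Implicit.
Unset Printing Implicit Defensive.
Local Open Scope classical_set_scope.
Local Open Scope ring_scope.
Local Open Scope complex_scope.

(** * Complex numbers of modulus one *)

Definition cis (R : realType) (t : R) : R[i] := cos t +i* sin t.

Lemma cis0 (R : realType) : cis 0 = 1 :> R[i].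
Proof. by rewrite /cis cos0 sin0. Qed.

Lemma cisD (R : realType) (s t : R) : cis (s + t) = cis s * cis t.
Proof.
by rewrite /cis cosD sinD; apply/eqP; rewrite eq_complex /= eqxx/= addrC mulrC; apply/eqP; ring.
Qed.

Lemma cis_neq0 (R : realType) (t : R) : cis t != 0.
Proof.
rewrite eq_complex /= negb_and; apply/orP.
have := cos2Dsin2 t; have [->|?] := eqVneq (cos t) 0; last by left.
rewrite expr0n/= add0r => h; right; apply: contra_eq_neq h => ->.
by rewrite expr0n eq_sym oner_eq0.
Qed.

Lemma cisN (R : realType) (t : R) : cis (- t) = (cis t)^-1.
Proof. by apply: (mulIf (cis_neq0 t)); rewrite -cisD addNr cis0 mulVf ?cis_neq0. Qed.

Lemma cisX (R : realType) (t : R) n : cis t ^+ n = cis (n%:R * t).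
Proof.
elim: n => [|n ih]; first by rewrite mul0r cis0.
by rewrite exprS ih -cisD -natr1; congr cis; ring.
Qed.

Lemma cis_pi (R : realType) : cis pi = -1 :> R[i].
Proof. by rewrite /cis cospi sinpi; apply/eqP; rewrite eq_complex/= oppr0 !eqxx. Qed.

Lemma cis_2pi (R : realType) : cis (pi *+ 2) = 1 :> R[i].
Proof. by rewrite /cis cos2pi sin2pi. Qed.

Lemma normc_cis (R : realType) (t : R) : normc (cis t) = 1.
Proof. by rewrite /normc/= cos2Dsin2 sqrtr1. Qed.

Lemma joukowski_cis (R : realType) (t : R) : joukowski (cis t : R[i]^o) = (cos t)%:C.
Proof.
rewrite /joukowski -cisN /cis cosN sinN.
have -> : (2 : R[i]) = 2%:C by rewrite rmorph_nat.
rewrite -fmorphV/=; apply/eqP; rewrite eq_complex /= subrr !mulr0 !mul0r addr0 subr0.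
by rewrite eqxx andbT; apply/eqP; field.
Qed.

Lemma normc_ge0 (R : realType) (z : R[i]) : 0 <= normc z.
Proof. by case: z => a b; rewrite sqrtr_ge0. Qed.

Lemma normc_eq0 (R : realType) (z : R[i]) : (normc z == 0) = (z == 0).
Proof. by apply/eqP/eqP => [/eq0_normc|->]; rewrite ?normc0. Qed.

Lemma normc_gt0 (R : realType) (z : R[i]) : (0 < normc z) = (z != 0).
Proof. by rewrite lt_def normc_eq0 normc_ge0 andbT. Qed.

Lemma normcX (R : realType) (z : R[i]) n : normc (z ^+ n) = normc z ^+ n.
Proof. by elim: n => [|n ih]; rewrite ?normc1// !exprS normcM ih. Qed.

Lemma normcD (R : realType) (z w : R[i]) : normc (z + w) <= normc z + normc w.
Proof. exact: le_normcD. Qed.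

Lemma normcNE (R : realType) (z : R[i]) : normc (- z) = normc z.
Proof. by case: z => a b /=; rewrite !sqrrN. Qed.

Lemma normcBC (R : realType) (z w : R[i]) : normc (z - w) = normc (w - z).
Proof. by rewrite -normcNE opprB. Qed.

Lemma normcB (R : realType) (z w : R[i]) : normc (z - w) <= normc z + normc w.
Proof. by rewrite -(normcNE w) normcD. Qed.

Lemma normc_real (R : realType) (x : R) : normc x%:C = `|x|.
Proof. by rewrite /normc/= expr0n/= addr0 sqrtr_sqr. Qed.

Lemma normc_nat (R : realType) n : normc (n%:R : R[i]) = n%:R :> R.
Proof. by rewrite -[n%:R](rmorph_nat (@real_complex R)) normc_real ger0_norm. Qed.

Lemma normc_sum (R : realType) I (r : seq I) (P : pred I) (F : I -> R[i]) :
  normc (\sum_(i <- r | P i) F i) <= \sum_(i <- r | P i) normc (F i).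
Proof.
elim/big_ind2: _ => [|x a y b xa yb|//]; first by rewrite normc0.
exact: le_trans (normcD _ _) (lerD xa yb).
Qed.

Lemma normc_ge_Re (R : realType) (z : R[i]) : `|complex.Re z| <= normc z.
Proof.
by case: z => a b; rewrite /normc/= -sqrtr_sqr ler_wsqrtr// lerDl sqr_ge0.
Qed.

(** Rotating by [c] turns a complex increment into a real one, to which the mean value theorem for
    real functions applies. *)
Lemma normc_rotation (R : realType) (z : R[i]) :
  exists2 c : R[i], normc c = 1 & c * z = (normc z)%:C.
Proof.
have [->|z0] := eqVneq z 0; first by exists 1; rewrite ?normc1// mulr0 normc0.
have nz0 : normc z != 0 by rewrite normc_eq0.
exists ((normc z)%:C / z); last by rewrite divfK.
by rewrite normcM normcV normc_real ger0_norm ?normc_ge0// divff.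
Qed.

Lemma normc_cis_sub1 (R : realType) (t : R) : normc (cis t - 1) = 2 * `|sin (t / 2)|.
Proof.
have -> : t = t / 2 + t / 2 by field.
set s := t / 2; have -> : (s + s) / 2 = s by field.
have -> : cis (s + s) - 1 = cis s * (cis s - cis (- s)).
  by rewrite mulrBr -!cisD subrr cis0.
rewrite normcM normc_cis mul1r.
have -> : cis s - cis (- s) = 0 +i* (2 * sin s).
  by rewrite /cis cosN sinN; apply/eqP; rewrite eq_complex /= subrr eqxx; apply/eqP; ring.
by rewrite /normc/= expr0n/= add0r sqrtr_sqr normrM ger0_norm.
Qed.

Lemma cis_sub1_neq0 (R : realType) (t : R) : 0 < t < pi *+ 2 -> cis t - 1 != 0.
Proof.
move=> /andP[t0 t2]; rewrite -normc_gt0 normc_cis_sub1 mulr_gt0// normr_gt0 gt_eqF//.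
by rewrite sin_gt0_pi// divr_gt0//= ltr_pdivrMr// mulr_natr.
Qed.

Lemma sum_expr_root (K : fieldType) (z : K) N :
  z ^+ N = 1 -> z != 1 -> \sum_(k < N) z ^+ k = 0.
Proof.
move=> zN z1; have := subrX1 z N; rewrite zN subrr => /esym/eqP.
by rewrite mulf_eq0 subr_eq0 (negbTE z1) => /eqP.
Qed.

(** Orthogonality of the [N]-th roots of unity: for [0 < m < N] the ratio of the geometric sum has
    [N]-th power 1 without being 1. *)
Lemma sum_cisX (R : realType) (N m : nat) : (0 < m < N)%N ->
  \sum_(k < N) cis (pi *+ 2 / N%:R : R) ^+ (k * m) = 0.
Proof.
move=> /andP[m0 mN]; have N0 : (0 < N)%N by apply: leq_ltn_trans mN.
have N0' : N%:R != 0 :> R by rewrite pnatr_eq0 -lt0n.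
under eq_bigr => k _ do rewrite mulnC exprM.
apply: sum_expr_root.
  by rewrite -exprM mulnC exprM [cis _ ^+ N]cisX mulrC divfK// cis_2pi expr1n.
have p2 : 0 < pi *+ 2 :> R by rewrite mulrn_wgt0 ?pi_gt0.
rewrite -subr_eq0 cisX cis_sub1_neq0//; apply/andP; split.
  by rewrite mulr_gt0 ?divr_gt0 ?ltr0n.
by rewrite mulrCA gtr_pMr// ltr_pdivrMr ?ltr0n// mul1r ltr_nat.
Qed.

(** * Chebyshev polynomials and the interpolation formula *)

Fixpoint chebT (R : realType) (n : nat) : {poly R[i]} :=
  match n with
  | 0%N => 1
  | m.+1 => match m with 0%N => 'X | k.+1 => 'X * chebT R m *+ 2 - chebT R k end
  end.

Lemma chebTSS (R : realType) n :
  chebT R n.+2 = 'X * chebT R n.+1 *+ 2 - chebT R n.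
Proof. by []. Qed.

Lemma size_chebT (R : realType) n : (size (chebT R n) <= n.+1)%N.
Proof.
elim/ltn_ind: n => -[|[|n]] ih; first by rewrite size_poly1.
  by rewrite size_polyX.
rewrite chebTSS (leq_trans (size_polyD _ _))// geq_max size_polyN; apply/andP; split.
  rewrite mulr2n (leq_trans (size_polyD _ _))// maxnn.
  by rewrite (leq_trans (size_polyMleq _ _))// size_polyX add2n /= ltnS; exact: ih.
by rewrite (leq_trans (ih n _)) // ltnW.
Qed.

Lemma horner_chebT (R : realType) (u : R[i]) n : u != 0 ->
  (chebT R n).[joukowski u] = (u ^+ n + u ^- n) / 2.
Proof.
move=> u0; elim/ltn_ind: n => -[|[|n]] ih.
- by rewrite hornerE invr1; field.
- by rewrite hornerX.
rewrite chebTSS !hornerE ih// ih// /joukowski !exprS.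
by field; rewrite expf_neq0.
Qed.

(** An induction principle for identities linear in [p]: since [2 X T_(k+1) = T_(k+2) + T_k], the
    product [X^m T_k] lies in the span of [T_0, ..., T_(m+k)], and [k = 0] gives the monomials. *)
Lemma chebT_span (R : realType) (P : {poly R[i]} -> Prop) n :
  (forall p q, P p -> P q -> P (p + q)) -> (forall c p, P p -> P (c *: p)) ->
  (forall k, (k <= n)%N -> P (chebT R k)) ->
  forall p : {poly R[i]}, (size p <= n.+1)%N -> P p.
Proof.
move=> PD PZ PT p sp.
have P0 : P 0 by rewrite -(scale0r (chebT R 0)); apply/PZ/PT.
have XT m : forall k, (m + k <= n)%N -> P ('X^m * chebT R k).
  elim: m => [|m ih] k mk; first by rewrite expr0 mul1r; apply: PT.
  case: k mk => [|k] mk.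
    by rewrite mulr1 exprSr; apply: (ih 1%N); rewrite addn1 -(addn0 m.+1).
  have -> : 'X^(m.+1) * chebT R k.+1 =
      2^-1 *: ('X^m * chebT R k.+2) + 2^-1 *: ('X^m * chebT R k).
    rewrite -scalerDr -mulrDr chebTSS subrK exprSr mulrnAr -[X in _ = _ *: X]scaler_nat scalerA.
    by rewrite mulVf ?pnatr_eq0// scale1r mulrA.
  by apply: PD; apply: PZ; apply: ih; lia.
rewrite -[p]coefK poly_def; elim/big_ind: _ => // i _.
apply: PZ; have := XT i 0%N; rewrite mulr1; apply.
by rewrite addn0 -ltnS (leq_trans (ltn_ord i)).
Qed.

Section Interpolation.
Variables (R : realType) (n : nat) (u : R[i]).
Hypotheses (n0 : (0 < n)%N) (u0 : u != 0).
Let z : R[i] := cis (pi / n%:R).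
Hypothesis uz : forall k, u != z ^+ k.

(** The points [z^k] are the [2n]-th roots of unity, whose Joukowski images are the unperturbed
    nodes. As [z^n = -1], the sign [(-1)^k] is [z^(kn)], so [S m] is a discrete Fourier coefficient
    of the kernel [(u + z^k) / (u - z^k)]. *)
Let S m := \sum_(k < 2 * n) (-1) ^+ k * z ^+ (k * m) * ((u + z ^+ k) / (u - z ^+ k)).

Let z_neq0 : z != 0. Proof. exact: cis_neq0. Qed.

Let zn : z ^+ n = -1.
Proof.
by rewrite cisX mulrC divfK ?pnatr_eq0 -?lt0n// cis_pi.
Qed.

Let z2n : z ^+ (2 * n) = 1.
Proof. by rewrite mulnC exprM zn sqrrN expr1n. Qed.

Let z_root : z = cis (pi *+ 2 / (2 * n)%:R).
Proof.
congr cis; rewrite natrM -mulr_natl; field.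
by rewrite pnatr_eq0 -lt0n.
Qed.

Let sum_sign m : (m < 2 * n)%N -> m != n ->
  \sum_(k < 2 * n) (-1) ^+ k * z ^+ (k * m) = 0.
Proof.
move=> m2n mn.
have -> : \sum_(k < 2 * n) (-1) ^+ k * z ^+ (k * m) =
          \sum_(k < 2 * n) z ^+ (k * ((n + m) %% (2 * n))).
  apply: eq_bigr => k _; rewrite -zn -exprM -exprD mulnC -mulnDr.
  rewrite [in LHS](divn_eq (n + m) (2 * n)) mulnDr exprD mulnA [(_ * (2 * n))%N]mulnC.
  by rewrite exprM z2n expr1n mul1r.
rewrite z_root sum_cisX// ltn_pmod ?andbT; last by lia.
rewrite lt0n; have [nm|nm] := leqP (2 * n) (n + m); last by rewrite modn_small; lia.
rewrite -(subnK nm) modnDr modn_small; lia.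
Qed.

Let sum_signn : \sum_(k < 2 * n) (-1) ^+ k * z ^+ (k * n) = (2 * n)%:R.
Proof.
rewrite -[RHS]mulr1 mulr_natl -[X in _ *+ X]card_ord -sumr_const.
apply: eq_bigr => k _; rewrite [(k * n)%N]mulnC exprM zn -exprD addnn -mul2n exprM.
by rewrite sqrrN expr1n expr1n.
Qed.

(** Writing [z^k = u - (u - z^k)] cancels the denominator in the second term. The signed sums left
    over vanish for indices up to [2n] other than [n], so [S] is geometric with ratio [u] except for
    jumps at [n] and [n + 1]. *)
Let SS m : S m.+1 = u * S m - (u * (\sum_(k < 2 * n) (-1) ^+ k * z ^+ (k * m)) +
  \sum_(k < 2 * n) (-1) ^+ k * z ^+ (k * m.+1)).
Proof.
rewrite /S !mulr_sumr -big_split -sumrB/=; apply: eq_bigr => k _.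
have : u - z ^+ k != 0 by rewrite subr_eq0 uz.
by rewrite mulnS exprD => ?; field.
Qed.

Let S_lo m : (m < n)%N -> S m = u ^+ m * S 0.
Proof.
elim: m => [|m ih] mn; first by rewrite mul1r.
by rewrite SS ih 1?ltnW// !sum_sign ?exprS; [ring|lia..].
Qed.

Let S_n : S n = u ^+ n * S 0 - (2 * n)%:R.
Proof.
case: n n0 SS sum_sign sum_signn S_lo => // m _ SSm ss ssn lo.
by rewrite SSm ssn lo// ss ?exprS; [ring|lia..].
Qed.

Let sum_sign2n : \sum_(k < 2 * n) (-1) ^+ k * z ^+ (k * (2 * n)) = 0.
Proof.
rewrite -[RHS](@sum_sign 0%N); [|lia..].
by apply: eq_bigr => k _; rewrite muln0 [(k * _)%N]mulnC exprM z2n expr1n.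
Qed.

Let sum_sign_hi m : (n < m <= 2 * n)%N ->
  \sum_(k < 2 * n) (-1) ^+ k * z ^+ (k * m) = 0.
Proof.
by move=> mn; have [->|m2n] := eqVneq m (2 * n)%N; [exact: sum_sign2n|apply: sum_sign; lia].
Qed.

Let S_hi i : (i < n)%N -> S (n.+1 + i) = u ^+ i * (u ^+ n.+1 * S 0 - (4 * n)%:R * u).
Proof.
elim: i => [|i ih] ni.
  have -> : (4 * n)%:R = (2 * n)%:R + (2 * n)%:R :> R[i] by rewrite -natrD; congr _%:R; lia.
  rewrite addn0 mul1r SS S_n sum_signn sum_sign_hi; last lia.
  by rewrite exprS; ring.
by rewrite addnS SS ih 1?ltnW// [u ^+ i.+1]exprS !sum_sign_hi; [ring|lia..].
Qed.

Let S_2n : S (2 * n) = S 0.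
Proof. by apply: eq_bigr => k _; rewrite muln0 [(k * _)%N]mulnC exprM z2n expr1n. Qed.

(** The period [2n] of [S] closes the recursion: [S 0 = u^(n-1) (u^(n+1) S 0 - 4 n u)]. *)
Lemma interpolation_kernel0 : S 0 * (u ^+ (2 * n) - 1) = (4 * n)%:R * u ^+ n.
Proof.
have n1n : (n.-1 < n)%N by lia.
have := S_hi n1n; have -> : (n.+1 + n.-1 = 2 * n)%N by lia.
rewrite S_2n => SE.
have e1 : u ^+ n.-1 * u ^+ n.+1 = u ^+ (2 * n) by rewrite -exprD; congr (_ ^+ _); lia.
have e2 : u ^+ n.-1 * u = u ^+ n by rewrite -exprSr prednK.
by rewrite mulrBr mulr1 [X in _ - X]SE -e1 -e2; ring.
Qed.

(** By linearity only [p = T_m] with [m <= n] is at stake, where the claim reads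
    [(u^m + u^-m) S 0 = S m + S (2n - m)]. The formula recovers [p] from its values at the
    unperturbed nodes, with [S 0] as normalization. *)
Lemma interpolation_kernel_horner (p : {poly R[i]}) : (size p <= n.+1)%N ->
  p.[joukowski u] * S 0 = \sum_(k < 2 * n)
    (-1) ^+ k * p.[joukowski (z ^+ k)] * ((u + z ^+ k) / (u - z ^+ k)).
Proof.
move: p; apply: chebT_span => [p q hp hq|c p hp|m mn].
- rewrite hornerD mulrDl hp hq -big_split; apply: eq_bigr => k _ /=.
  by rewrite hornerD mulrDr mulrDl.
- rewrite hornerZ -mulrA hp mulr_sumr; apply: eq_bigr => k _ /=.
  by rewrite hornerZ; ring.
rewrite horner_chebT//.
have -> : \sum_(k < 2 * n) (-1) ^+ k * (chebT R m).[joukowski (z ^+ k)] *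
    ((u + z ^+ k) / (u - z ^+ k)) = (S m + S (2 * n - m)) / 2.
  rewrite /S -big_split mulr_suml; apply: eq_bigr => k _ /=.
  rewrite horner_chebT ?expf_neq0//.
  have -> : z ^+ (k * (2 * n - m)) = z ^+ k ^- m.
    rewrite exprM; apply: (mulIf (expf_neq0 m (expf_neq0 k z_neq0))).
    rewrite mulVf ?expf_neq0// -exprD subnK; last lia.
    by rewrite -exprM mulnC exprM z2n expr1n.
  rewrite -exprM; have : u - z ^+ k != 0 by rewrite subr_eq0 uz.
  by move=> uzk; field; rewrite ?z_neq0 ?uzk ?expf_neq0 ?z_neq0.
have E := interpolation_kernel0.
(* For [m = n] both terms are [S n], whose jump by [2n] is compensated by the closed form of [S 0];
   for [m < n] only [S (2n - m)] lies past the jumps. *)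
have [->|mn'] := eqVneq m n.
  have -> : (2 * n - n = n)%N by lia.
  have un : u ^+ n != 0 by rewrite expf_neq0.
  rewrite S_n; apply: (mulIf un); apply: (mulIf (x := 2)); first by rewrite pnatr_eq0.
  move: E; rewrite mul2n -addnn exprD natrM => E.
  have {}E : S 0 * (u ^+ n * u ^+ n) = 4 * n%:R * u ^+ n + S 0.
    by rewrite -E mulrBr mulr1 subrK.
  have -> : (u ^+ n + u ^- n) / 2 * S 0 * u ^+ n * 2 = S 0 * (u ^+ n * u ^+ n) + S 0.
    by field.
  rewrite natrD; set s := S 0 in E *; set N := n%:R in E *.
  have -> : (u ^+ n * s - (N + N) + (u ^+ n * s - (N + N))) / 2 * u ^+ n * 2 =
    2 * (s * (u ^+ n * u ^+ n)) - 4 * N * u ^+ n by field.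
  by rewrite E; ring.
have mn1 : (m < n)%N by rewrite ltn_neqAle mn'.
have -> : (2 * n - m = n.+1 + (n.-1 - m))%N by lia.
rewrite S_hi; last lia.
rewrite [S m]S_lo//.
have um : u ^+ m != 0 by rewrite expf_neq0.
apply: (mulIf um).
have e1 : u ^+ (n.-1 - m) * u ^+ m = u ^+ n.-1 by rewrite -exprD subnK//; lia.
have e2 : u ^+ n.-1 * u ^+ n.+1 = u ^+ (2 * n) by rewrite -exprD; congr (_ ^+ _); lia.
have e3 : u ^+ n.-1 * u = u ^+ n by rewrite -exprSr prednK.
have -> : (u ^+ m * S 0 + u ^+ (n.-1 - m) * (u ^+ n.+1 * S 0 - (4 * n)%:R * u)) / 2 * u ^+ m =
   (u ^+ m * u ^+ m * S 0 + ((u ^+ n.-1 * u ^+ n.+1) * S 0 - (4 * n)%:R * (u ^+ n.-1 * u))) / 2.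
  by rewrite -e1; field.
rewrite e2 e3 -E; field.
by [].
Qed.

End Interpolation.

(** * Lebesgue constant of the Chebyshev nodes *)

Lemma sin_le_id (R : realType) (x : R) : 0 <= x -> sin x <= x.
Proof.
move=> x0; have [|c _] := @MVT_segment R sin cos 0 x x0 (fun y _ => is_derive_sin y).
  exact/continuous_subspaceT/continuous_sin.
by rewrite sin0 !subr0 => ->; rewrite ler_piMl// cos_le1.
Qed.

Lemma mul_cos_le_sin (R : realType) (x : R) : 0 <= x <= pi -> x * cos x <= sin x.
Proof.
move=> /andP[x0 xpi]; have D (y : R) : is_derive y 1 (fun y => sin y - y * cos y) (y * sin y).
  by apply: is_derive_eq; rewrite /GRing.scale/=; ring.
have [|c] := @MVT_segment R _ _ 0 x x0 (fun y _ => D y).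
  apply: continuous_subspaceT => y; apply: differentiable_continuous.
  by apply/derivable1_diffP; have [] := D y.
rewrite in_itv/= => /andP[c0 cx]; rewrite sin0 mul0r !subr0 => E.
by rewrite -subr_ge0 E !mulr_ge0// sin_ge0_pi// c0 (le_trans cx).
Qed.

(** This is [|cot (t / 2)|]; at multiples of [2 pi] it is 0, as division by 0 gives 0. *)
Definition chord_ratio (R : realType) (t : R) := normc (cis t + 1) / normc (cis t - 1).

Lemma chord_ratio_ge0 (R : realType) (t : R) : 0 <= chord_ratio t.
Proof. by rewrite divr_ge0// normc_ge0. Qed.

Lemma chord_ratio_periodic (R : realType) (t : R) : chord_ratio (t + pi *+ 2) = chord_ratio t.
Proof. by rewrite /chord_ratio {1 2}/cis sinD2pi cosD2pi. Qed.

Lemma chord_ratioN (R : realType) (t : R) : chord_ratio (- t) = chord_ratio t.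
Proof.
have nt : normc (cis t)^-1 = 1 by rewrite normcV normc_cis invr1.
rewrite /chord_ratio cisN.
have -> : (cis t)^-1 + 1 = (cis t)^-1 * (cis t + 1) by rewrite mulrDr mulVf ?cis_neq0 ?mulr1 1?addrC.
have -> : (cis t)^-1 - 1 = - ((cis t)^-1 * (cis t - 1)).
  by rewrite mulrBr mulVf ?cis_neq0 ?mulr1 ?opprB.
by rewrite normcNE !normcM nt !mul1r.
Qed.

Lemma chord_ratioE (R : realType) (s t : R) :
  normc ((cis s + cis t) / (cis s - cis t)) = chord_ratio (s - t).
Proof.
have -> : cis s + cis t = cis t * (cis (s - t) + 1) by rewrite mulrDr -cisD mulr1 [t + _]addrC subrK.
have -> : cis s - cis t = cis t * (cis (s - t) - 1) by rewrite mulrBr -cisD mulr1 [t + _]addrC subrK.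
by rewrite normcM normcV !normcM normc_cis !mul1r.
Qed.

Lemma chord_ratio_le (R : realType) (t : R) : 0 < t < pi -> chord_ratio t <= 2 / t.
Proof.
move=> /andP[t0 tpi].
have h0 : 0 < t / 2 by rewrite divr_gt0.
have hpi : t / 2 < pi / 2 by rewrite ltr_pM2r ?invr_gt0.
have hh : pi / 2 < pi :> R by rewrite ltr_pdivrMr// ltr_pMr ?pi_gt0// ltr1n.
have s0 : 0 < sin (t / 2) by rewrite sin_gt0_pi// h0 (lt_trans hpi).
have c0 : 0 < cos (t / 2) by rewrite cos_gt0_pihalf// hpi (lt_trans _ h0)// oppr_lt0 divr_gt0 ?pi_gt0.
rewrite /chord_ratio normc_cis_sub1.
have -> : cis t + 1 = - (cis (t + pi) - 1).
  by rewrite cisD cis_pi mulrN1 opprB opprK addrC.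
rewrite normcNE normc_cis_sub1.
have -> : (t + pi) / 2 = t / 2 + pi / 2 by field.
rewrite sinDpihalf !gtr0_norm//.
rewrite ler_pdivrMr ?mulr_gt0// mulrAC ler_pdivlMr//.
have := @mul_cos_le_sin R (t / 2); rewrite (ltW h0) (ltW (lt_trans hpi hh)) => /(_ isT) h.
have -> : 2 * cos (t / 2) * t = 4 * (t / 2 * cos (t / 2)) by field.
by apply: (@le_trans _ _ (4 * sin (t / 2))); [rewrite ler_pM2l|lra].
Qed.

Section LebesgueConstant.
Variables (R : realType) (n : nat).
Hypothesis n0 : (0 < n)%N.
Let h : R := pi / n%:R.
Let F := @chord_ratio R.
(** The sum of the moduli of the kernel of the interpolation formula at [u = cis t], where [h] is
    the angle between neighbouring nodes. *)
Let G (t : R) := \sum_(k < 2 * n) F (t - k%:R * h).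

Let n0' : 0 < n%:R :> R. Proof. by rewrite ltr0n. Qed.
Let h_gt0 : 0 < h. Proof. by rewrite divr_gt0 ?pi_gt0. Qed.
Let nh : n%:R * h = pi. Proof. by rewrite mulrC divfK ?gt_eqF. Qed.

Let G_shift t : G (t + h) = G t.
Proof.
rewrite /G; have -> : (2 * n = (2 * n).-1.+1)%N by lia.
rewrite big_ord_recl [in RHS]big_ord_recr addrC; congr +%R.
  by apply: eq_bigr => k _; congr F; rewrite /= /bump/= add1n -natr1; ring.
rewrite /F -[RHS]chord_ratio_periodic; congr chord_ratio => /=.
have -> : (2 * n).-1%:R = 2 * n%:R - 1 :> R.
  by rewrite -natrM -[1]/(1%:R) -natrB; [congr _%:R|]; lia.
by rewrite mulrBl -mulrA nh; ring.
Qed.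

Let G_shiftn t k : G (t + k%:R * h) = G t.
Proof.
elim: k => [|k ih]; first by rewrite mul0r addr0.
by rewrite -natr1 mulrDl mul1r addrA G_shift.
Qed.

(** As [F] is even and [2 pi]-periodic, the summands can be grouped by the side of [t] on which the
    root lies. For [0 < t < h] all arguments then lie in [(0, pi)], where [chord_ratio_le]
    applies. *)
Let G_split t : G t = \sum_(0 <= i < n) F (t + i%:R * h) +
  \sum_(0 <= i < n) F (h - t + i%:R * h).
Proof.
rewrite !big_mkord -(G_shiftn t n.-1) /G.
rewrite -(big_mkord xpredT (fun k => F (t + n.-1%:R * h - k%:R * h))).
rewrite (@big_cat_nat _ _ _ n)//=; last by lia.
congr +%R.
  rewrite big_nat_rev/= add0n big_mkord; apply: eq_bigr => i _; congr F.
  have -> : (n - i.+1)%:R = n.-1%:R - i%:R :> R by rewrite -natrB; [congr _%:R|]; have := ltn_ord i; lia.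
  by ring.
rewrite -{1}[n]add0n big_addn mul2n -addnn addnK big_mkord; apply: eq_bigr => i _.
rewrite /F -chord_ratioN; congr chord_ratio.
have -> : n.-1%:R = n%:R - 1 :> R by rewrite -[1]/(1%:R) -natrB//; congr _%:R; lia.
by rewrite natrD; ring.
Qed.

Let tail_le (a : R) : 0 < a < h ->
  \sum_(1 <= i < n) F (a + i%:R * h) <= 2 * n%:R / pi * \sum_(1 <= i < n) i%:R^-1.
Proof.
move=> /andP[a0 ah]; rewrite mulr_sumr; apply: ler_sum_nat => i /andP[i1 ni].
have i0 : 0 < i%:R :> R by rewrite ltr0n.
have ih : 0 < i%:R * h by rewrite mulr_gt0.
have t0 : 0 < a + i%:R * h by rewrite addr_gt0.
apply: (le_trans (chord_ratio_le _)).
  rewrite t0/= -nh (@lt_le_trans _ _ (h + i%:R * h)) ?ltrD2r//.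
  by rewrite -[X in X + _]mul1r -mulrDl nat1r ler_pM2r// ler_nat.
have -> : 2 * n%:R / pi * i%:R^-1 = 2 / (i%:R * h).
  by rewrite /h; move: (@pi R) (pi_gt0 R) => p p0; field; rewrite !gt_eqF.
by rewrite ler_pM2l// lef_pV2 ?posrE// lerDr ltW.
Qed.

(** The nearest root contributes at most [2 / a], which [sin (n a) <= n a] compensates; the next one
    is at distance [h - a >= h / 2] and contributes at most [4 n / pi]. *)
Let head_le (a : R) : 0 < a <= h / 2 ->
  sin (n%:R * a) * (F a + F (h - a)) <= 2 * n%:R * (1 + 2 / pi).
Proof.
move=> /andP[a0 ah].
have hpi : h <= pi by rewrite -nh ler_peMl ?ler1n// ltW.
have ah' : a < h by lra.
have na0 : 0 < n%:R * a by rewrite mulr_gt0.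
have s0 : 0 <= sin (n%:R * a).
  by rewrite sin_ge0_pi// (ltW na0)/= -nh ler_pM2l// ltW.
rewrite mulrDr [leRHS]mulrDr mulr1; apply: lerD.
  apply: (@le_trans _ _ (n%:R * a * (2 / a))); last first.
    by rewrite le_eqVlt; apply/orP; left; apply/eqP; field; rewrite gt_eqF.
  apply: ler_pM => //; first exact: chord_ratio_ge0.
    exact/sin_le_id/ltW.
  by apply: chord_ratio_le; lra.
have ha : 0 < h - a by rewrite subr_gt0.
apply: (@le_trans _ _ (1 * (2 / (h - a)))).
  apply: ler_pM => //; first exact: chord_ratio_ge0.
  by apply: chord_ratio_le; lra.
have -> : 2 * n%:R * (2 / pi) = 2 / (h / 2).
  by rewrite /h; move: (@pi R) (pi_gt0 R) => p p0; field; rewrite !gt_eqF.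
by rewrite mul1r ler_pM2l// lef_pV2 ?posrE//; lra.
Qed.

(** Induction on [1 / m <= 2 / (m + 1) <= 2 (ln (m + 1) - ln m)]. The crude factor 2 is absorbed in
    [G_le]. *)
Let sum_inv_le : \sum_(1 <= i < n) i%:R^-1 <= 2 * ln n%:R :> R.
Proof.
case: n n0 => // m _; elim: m => [|m ih]; first by rewrite big_geq// ln1 mulr0.
rewrite big_nat_recr//=; have m0 : 0 < m.+1%:R :> R by rewrite ltr0n.
have mm0 : 0 < m.+2%:R :> R by rewrite ltr0n.
have -> : ln m.+2%:R = ln m.+1%:R - ln (1 - m.+2%:R^-1) :> R.
  have -> : 1 - m.+2%:R^-1 = m.+1%:R / m.+2%:R :> R.
    move: m0 mm0; rewrite -[m.+2%:R]natr1; move: (m.+1%:R) => M M0 M1.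
    by field; rewrite gt_eqF.
  by rewrite ln_div ?posrE//; ring.
have := @le_ln1Dx R (- m.+2%:R^-1); rewrite ltrN2 invf_lt1// ltr1n => /(_ isT) l.
have : m.+1%:R^-1 <= 2 * m.+2%:R^-1 :> R.
  rewrite ler_pdivlMr// mulrC ler_pdivrMr//.
  have : 1 <= m.+1%:R :> R by rewrite ler1n.
  by rewrite -[m.+2%:R]natr1; lra.
by move=> l2; apply: (le_trans (lerD ih l2)); rewrite mulrBr lerD2l -mulrN ler_pM2l// lerNr.
Qed.

Let G_le (a : R) : 0 < a <= h / 2 ->
  sin (n%:R * a) * G a <= 2 * n%:R * ((1 + 2 / pi) * (1 + ln n%:R)).
Proof.
move=> /[dup] ah2 /andP[a0 ah].
have hpi : h <= pi by rewrite -nh ler_peMl ?ler1n// ltW.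
have ah' : a < h by lra.
have na0 : 0 < n%:R * a by rewrite mulr_gt0.
have s0 : 0 <= sin (n%:R * a).
  by rewrite sin_ge0_pi// (ltW na0)/= -nh ler_pM2l// ltW.
rewrite G_split !(@big_ltn _ _ _ 0%N)//.
rewrite mul0r !addr0 addrACA mulrDr.
apply: (@le_trans _ _ (2 * n%:R * (1 + 2 / pi) + 1 * (2 * (2 * n%:R / pi * (2 * ln n%:R))))).
  apply: lerD; first exact: head_le.
  apply: ler_pM => //; rewrite ?sin_le1//.
    by apply: addr_ge0; apply: sumr_ge0 => i _; exact: chord_ratio_ge0.
  have c0 : 0 <= 2 * n%:R / pi :> R by rewrite divr_ge0 ?mulr_ge0 ?pi_ge0// ltW.
  rewrite [leRHS]mulr_natl mulr2n; apply: lerD.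
    by apply: le_trans (tail_le _) _; rewrite ?a0// ler_wpM2l.
  by apply: le_trans (tail_le _) _; rewrite ?ler_wpM2l//; lra.
have -> : 2 * n%:R * ((1 + 2 / pi) * (1 + ln n%:R)) =
  2 * n%:R * (1 + 2 / pi) + 2 * n%:R * ((1 + 2 / pi) * ln n%:R) :> R by ring.
rewrite lerD2l mul1r.
have -> : 2 * (2 * n%:R / pi * (2 * ln n%:R)) = 2 * n%:R * (4 / pi * ln n%:R) :> R by ring.
rewrite ler_pM2l ?mulr_gt0// ler_wpM2r ?ln_ge0 ?ler1n//.
(* The logarithmic terms require [4 / pi <= 1 + 2 / pi], that is [pi >= 2]. *)
have p2 : 2 <= pi :> R by exact: pi_ge2.
by rewrite -lerBlDr -mulrBl ler_pdivrMr ?pi_gt0//; lra.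
Qed.

Let G_le_itv (a : R) : 0 < a < h ->
  sin (n%:R * a) * G a <= 2 * n%:R * ((1 + 2 / pi) * (1 + ln n%:R)).
Proof.
move=> /andP[a0 ah]; have [ah2|ah2] := leP a (h / 2); first by rewrite G_le// a0.
have -> : sin (n%:R * a) = sin (n%:R * (h - a)) by rewrite mulrBr nh sinB sinpi cospi; ring.
have -> : G a = G (h - a) by rewrite !G_split addrC subKr.
by apply: G_le; lra.
Qed.

(** Write [x = cos t] and [t = a + j h] with [0 <= a < h]. If [a = 0] then [x] is a node; otherwise
    take moduli in the interpolation formula, where [|S 0| = 2 n / sin (n a)] makes the
    amplification at most [sin (n a) G a / (2 n)]. *)
Lemma chebyshev_lebesgue_le (p : {poly R[i]}) (mu : R) : (size p <= n.+1)%N ->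
  (forall j, (j <= n)%N -> normc p.[(cos (j%:R * pi / n%:R))%:C] <= mu) ->
  forall x, -1 <= x <= 1 ->
  normc p.[x%:C] <= (1 + 2 / pi) * (1 + ln n%:R) * mu.
Proof.
move=> sp pmu x x1; have mu0 : 0 <= mu by exact: le_trans (normc_ge0 _) (pmu 0%N _).
have L1 : 1 <= (1 + 2 / pi) * (1 + ln n%:R) :> R.
  rewrite -[X in X <= _](mulr1 1) ler_pM// lerDl ?ln_ge0 ?ler1n//.
  by rewrite divr_ge0 ?pi_ge0.
have pmu2 k : (k < 2 * n)%N -> normc p.[joukowski (cis h ^+ k)] <= mu.
  move=> k2n; rewrite cisX joukowski_cis.
  have [kn|kn] := leqP k n; first by rewrite /h mulrA pmu.
  (* Roots in the lower half circle have the same real part as their conjugates. *)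
  have -> : cos (k%:R * h) = cos ((2 * n - k)%N%:R * h).
    rewrite natrB 1?ltnW// mulrBl natrM -mulrA nh [2 * pi]mulr_natl.
    by rewrite -[RHS]cosN opprB -[RHS]cosD2pi subrK.
  by rewrite /h mulrA pmu//; lia.
rewrite -(acosK x1); move: (acos_ge0 x1) (acos_lepi x1).
move: (acos x) => t t0 tpi.
have th0 : 0 <= t / h by rewrite divr_ge0// ltW.
have /andP[] := truncn_itv th0; move: (Num.truncn _) => j jt tj.
have jn : (j <= n)%N.
  by rewrite -(ler_nat R) (le_trans jt)// ler_pdivrMr// nh.
have [a tE] : exists a, t = a + j%:R * h by exists (t - j%:R * h); rewrite subrK.
move: jt; rewrite ler_pdivlMr// tE lerDr le_eqVlt => /orP[/eqP a0|a0].
  by rewrite -a0 add0r /h mulrA (le_trans (pmu j jn))// ler_peMl.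
have ah : a < h.
  by move: tj; rewrite ltr_pdivrMr// tE -natr1 mulrDl mul1r [ltRHS]addrC ltrD2r.
rewrite -tE.
have na : 0 < n%:R * a < pi by rewrite mulr_gt0//= -nh ltr_pM2l.
have s0 : 0 < sin (n%:R * a) by rewrite sin_gt0_pi.
have u2n : normc (cis t ^+ (2 * n) - 1) = 2 * sin (n%:R * a).
  rewrite cisX tE mulrDr natrM mulrCA -[2 * n%:R * h]mulrA nh cisD -cisX.
  rewrite [2 * pi]mulr_natl cis_2pi expr1n mulr1 normc_cis_sub1.
  have -> : 2 * n%:R * a / 2 = n%:R * a by field.
  by rewrite gtr0_norm.
have uz k : cis t != cis h ^+ k.
  apply/eqP => uzk; move: u2n; rewrite uzk -exprM.
  have e : (k * (2 * n) = n * (2 * k))%N.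
    by rewrite mulnCA [RHS]mulnCA [(n * k)%N]mulnC.
  rewrite e.
  rewrite exprM cisX nh cis_pi exprM sqrrN !expr1n subrr normc0 => /eqP.
  by rewrite eq_sym gt_eqF ?mulr_gt0.
have u0 := cis_neq0 t.
have E2 := interpolation_kernel0 n0 u0 uz.
move: (interpolation_kernel_horner n0 u0 uz sp) E2; rewrite -joukowski_cis.
set S := (X in _ * X = _) => E1 E2.
have NS : normc S * (2 * sin (n%:R * a)) = 4 * n%:R.
  by rewrite -u2n -normcM E2 normcM normcX normc_cis expr1n mulr1 normc_nat natrM.
have := congr1 (@normc R) E1; rewrite normcM => E.
have : normc p.[joukowski (cis t)] * normc S <= mu * G a.
  rewrite E -(G_shiftn a j) -tE mulr_sumr; apply: le_trans (normc_sum _ _ _) _.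
  apply: ler_sum => k _; rewrite !normcM normcX normcNE normc1 expr1n mul1r.
  rewrite -normcM cisX chord_ratioE -cisX ler_wpM2r ?chord_ratio_ge0//.
  exact: pmu2.
move=> le1.
have := @G_le_itv a; rewrite a0 ah => /(_ isT) le2.
have : normc p.[joukowski (cis t)] * (4 * n%:R) <=
    mu * (2 * (2 * n%:R * ((1 + 2 / pi) * (1 + ln n%:R)))).
  rewrite -NS mulrA; apply: le_trans (_ : mu * G a * (2 * sin (n%:R * a)) <= _).
    by rewrite ler_pM2r ?mulr_gt0.
  rewrite -mulrA ler_wpM2l// mulrCA ler_pM2l// mulrC//.
have -> : mu * (2 * (2 * n%:R * ((1 + 2 / pi) * (1 + ln n%:R)))) =
  (1 + 2 / pi) * (1 + ln n%:R) * mu * (4 * n%:R) by ring.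
by rewrite ler_pM2r// mulr_gt0.
Qed.

End LebesgueConstant.

(** * Bernstein's inequality and perturbed nodes *)

Section Riesz.
Variables (R : realType) (n : nat).
Hypothesis n0 : (0 < n)%N.
(** For [k < 2n] these are the solutions of [z^(2n) = -1], the sample rotations of Riesz's
    formula. *)
Let z (k : nat) : R[i] := cis (pi / (2 * n)%:R) * cis (pi *+ 2 / (2 * n)%:R) ^+ k.
Let A e := \sum_(k < 2 * n) z k ^+ e.+1 / (z k - 1) ^+ 2.

Let nn0 : (2 * n)%:R != 0 :> R. Proof. by rewrite pnatr_eq0 -lt0n muln_gt0. Qed.

Let zX k : z k ^+ (2 * n) = -1.
Proof.
rewrite /z exprMn -exprM [(k * _)%N]mulnC [_ ^+ (_ * k)]exprM ![_ ^+ (2 * n)]cisX.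
have -> : (2 * n)%:R * (pi / (2 * n)%:R) = pi :> R by rewrite mulrC divfK.
have -> : (2 * n)%:R * (pi *+ 2 / (2 * n)%:R) = pi *+ 2 :> R by rewrite mulrC divfK.
by rewrite cis_pi cis_2pi expr1n mulr1.
Qed.

Let z_cis k : exists t, z k = cis t.
Proof. by eexists; rewrite /z cisX -cisD. Qed.

Let z1 k : z k - 1 != 0.
Proof.
rewrite subr_eq0; apply/eqP => zk; have := zX k; rewrite zk expr1n => /eqP.
by rewrite -addr_eq0 -mulr2n pnatr_eq0.
Qed.

Let B0 e : (0 < e < 2 * n)%N -> \sum_(k < 2 * n) z k ^+ e = 0.
Proof.
move=> en; under eq_bigr => k _ do rewrite /z exprMn -exprM.
by rewrite -mulr_sumr sum_cisX// mulr0.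
Qed.

Let ASS e : A e.+2 = 2 * A e.+1 - A e + \sum_(k < 2 * n) z k ^+ e.+1.
Proof.
rewrite /A mulr_sumr -sumrB -big_split/=; apply: eq_bigr => k _.
by have := z1 k; rewrite !exprS => h; field.
Qed.

Let A_lin e : (e < 2 * n)%N ->
  A e = A 0 + e%:R * (A 1 - A 0) /\ A e.+1 = A 0 + e.+1%:R * (A 1 - A 0).
Proof.
elim: e => [|e ih] en; first by split; ring.
have [ih1 ih2] := ih (ltnW en); split => //.
by rewrite ASS B0// ih1 ih2 -[e.+2%:R]natr1 -[e.+1%:R]natr1; ring.
Qed.

Let A_2n e : A (2 * n + e) = - A e.
Proof.
rewrite /A -sumrN; apply: eq_bigr => k _.
by rewrite -addnS exprD zX mulN1r mulNr.
Qed.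

(** The second differences of [A] are power sums of the roots, zero for exponents strictly between 0
    and [2n], so [A] is affine on [0, ..., 2n]. The rule [A (2n + e) = - A e], at [e = 0] and
    [e = 1], then fixes both coefficients. *)
Let AE e : (e <= 2 * n)%N -> A e = n%:R * (e%:R - n%:R).
Proof.
have n1 : (2 * n).-1.+1 = (2 * n)%N by rewrite prednK// muln_gt0.
have [A1 A2] : A (2 * n).-1 = A 0 + (2 * n).-1%:R * (A 1 - A 0) /\
    A (2 * n).-1.+1 = A 0 + (2 * n).-1.+1%:R * (A 1 - A 0).
  by apply: A_lin; rewrite n1.
have A3 : A (2 * n).-1.+2 = 2 * A (2 * n).-1.+1 - A (2 * n).-1 - (2 * n)%:R.
  rewrite ASS; congr (_ + _).
  under eq_bigr => k _ do rewrite n1 zX.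
  by rewrite sumr_const card_ord mulNrn.
have e2 := A_2n 0; have e3 := A_2n 1; rewrite addn0 in e2; rewrite addn1 in e3.
rewrite n1 e2 in A2; rewrite n1 e2 e3 A1 in A3.
have e4 : (2 * n).-1%:R = 2 * n%:R - 1 :> R[i].
  by rewrite -natrM -[in RHS]n1 -natr1 addrK.
rewrite e4 natrM in A3; rewrite natrM in A2.
have A0 : A 0 = - n%:R * (A 1 - A 0).
  apply: (mulfI (x := 2)); first by rewrite pnatr_eq0.
  have -> : 2 * A 0 = A 0 - (- A 0) by ring.
  by rewrite [X in _ - X]A2; ring.
have d : A 1 - A 0 = n%:R.
  have h : - A 1 = 2 * - A 0 - (A 0 + (2 * n%:R - 1) * (A 1 - A 0)) - 2 * n%:R by exact: A3.
  apply: (mulfI (x := 2)); first by rewrite pnatr_eq0.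
  have h2 : A 1 = A 0 + (A 1 - A 0) by ring.
  move: h A0; rewrite h2; have -> : A 0 + (A 1 - A 0) - A 0 = A 1 - A 0 by ring.
  move: (A 1 - A 0) => D; move: (A 0) => a; move: (n%:R) => N h aE.
  apply/eqP; rewrite eq_sym -subr_eq0.
  have -> : 2 * N - 2 * D = - (a + D) - (2 * - a - (a + (2 * N - 1) * D) - 2 * N).
    by rewrite aE; ring.
  by rewrite h subrr.
move=> e2n; have -> : A e = A 0 + e%:R * (A 1 - A 0).
  by case: e e2n => [|e] e2n; [rewrite mul0r addr0|have [] := A_lin e2n].
by rewrite d A0 d; ring.
Qed.

(** The left side is [n] times [u d/du] of [p (J u)]. For [p = T_m], which suffices by linearity, it
    is [n m (u^m - u^-m) / 2], while the right side is [(u^m A (n + m) + u^-m A (n - m)) / 2] with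
    [A (n + m) = n m] and [A (n - m) = - n m]. *)
Lemma riesz_formula (p : {poly R[i]}) (u : R[i]) : (size p <= n.+1)%N -> u != 0 ->
  n%:R * (p^`().[joukowski u] * ((u - u^-1) / 2)) =
  \sum_(k < 2 * n) z k ^+ n.+1 / (z k - 1) ^+ 2 * p.[joukowski (u * z k : R[i])].
Proof.
move=> sp u0; move: p sp; apply: chebT_span => [p q hp hq|c p hp|m mn].
- rewrite derivD !hornerD mulrDl mulrDr hp hq -big_split; apply: eq_bigr => k _ /=.
  by rewrite hornerD mulrDr.
- rewrite derivZ !hornerZ -mulrA mulrCA hp mulr_sumr; apply: eq_bigr => k _ /=.
  by rewrite hornerZ mulrCA.
have -> : (chebT R m)^`().[joukowski u] * ((u - u^-1) / 2) = m%:R * (u ^+ m - u ^- m) / 2.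
  elim/ltn_ind: m {mn} => -[|[|m]] ih.
  - by rewrite derivC horner0 !mul0r.
  - by rewrite derivX hornerC; field.
  have := ih m (leqW (leqnn _)); have := ih m.+1 (leqnn _).
  set d1 := (chebT R m.+1)^`().[_]; set d0 := (chebT R m)^`().[_] => h1 h0.
  have TE := horner_chebT m.+1 u0; have JE : joukowski u = (u + u^-1) / 2 :> R[i] by [].
  move: (joukowski u : R[i]) @d1 @d0 h1 h0 TE JE => J d1 d0 h1 h0 TE JE.
  have -> : (chebT R m.+2)^`().[J] = 2 * (chebT R m.+1).[J] + 2 * J * d1 - d0.
    rewrite chebTSS derivB derivMn derivM derivX mul1r.
    by rewrite hornerD hornerN hornerMn hornerD hornerM hornerX -/d1 -/d0; ring.
  have -> : (2 * (chebT R m.+1).[J] + 2 * J * d1 - d0) *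
    ((u - u^-1) / 2) = (chebT R m.+1).[J] * (u - u^-1) +
    2 * J * (d1 * ((u - u^-1) / 2)) - d0 * ((u - u^-1) / 2) by field; rewrite ?u0.
  rewrite h1 h0 TE JE -[m.+2%:R]natr1 -[m.+1%:R]natr1 !exprS.
  by field; rewrite expf_neq0// u0.
have zn0 k : z k != 0 by have [t ->] := z_cis k; exact: cis_neq0.
have -> : \sum_(k < 2 * n) z k ^+ n.+1 / (z k - 1) ^+ 2 *
    (chebT R m).[joukowski (u * z k : R[i])] = (u ^+ m * A (n + m) + u ^- m * A (n - m)) / 2.
  rewrite /A !mulr_sumr -big_split mulr_suml; apply: eq_bigr => k _ /=.
  have uzk : u * z k != 0 by rewrite mulf_neq0.
  rewrite (horner_chebT m uzk).
  rewrite !(exprMn _ u).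
  have -> : z k ^+ n.+1 = z k ^+ (n - m).+1 * z k ^+ m by rewrite -exprD addSn subnK.
  rewrite -addSn exprD.
  have -> : z k ^+ n.+1 = z k ^+ (n - m).+1 * z k ^+ m by rewrite -exprD addSn subnK.
  by have := z1 k => h; field; rewrite ?expf_neq0 ?zn0 ?u0 ?h.
rewrite !AE ?mul2n -?addnn ?leq_add2l//; last by rewrite (leq_trans (leq_subr _ _))// leq_addr.
by rewrite natrD natrB//; ring.
Qed.

(** On the unit circle [(z - 1)^2 = z (2 cos t - 2)], with a nonpositive real factor. Each modulus
    is therefore [- z / (z - 1)^2], and the sum is [- A 0 = A (2n)]. *)
Lemma riesz_weights : \sum_(k < 2 * n) normc (z k ^+ n.+1 / (z k - 1) ^+ 2) = n%:R ^+ 2.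
Proof.
apply: (fmorph_inj (@real_complex R)).
transitivity (A (2 * n)); last first.
  by rewrite AE// mul2n -addnn natrD rmorphXn/= rmorph_nat; ring.
rewrite -(addn0 (2 * n)%N) A_2n addn0 rmorph_sum -sumrN; apply: eq_bigr => k _ /=.
have [t zt] := z_cis k; have zk0 : z k != 0 by rewrite zt cis_neq0.
have E : (z k - 1) ^+ 2 = z k * (2 * cos t - 2)%:C.
  have -> : (2 * cos t - 2)%:C = z k + (z k)^-1 - 2.
    have := joukowski_cis t; rewrite /joukowski -zt => jt.
    by rewrite rmorphB rmorphM/= rmorph_nat -jt; field.
  by field.
have c1 : 2 * cos t - 2 <= 0 by have := cos_le1 t; lra.
have c0 : (2 * cos t - 2)%:C != 0.
  by have := expf_neq0 2 (z1 k); rewrite E mulf_eq0 negb_or => /andP[].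
rewrite E; have -> : normc (z k ^+ n.+1 / (z k * (2 * cos t - 2)%:C)) = (- (2 * cos t - 2))^-1.
  by rewrite normcM normcV normcM normcX zt normc_cis expr1n !mul1r normc_real ler0_norm.
move: c0; rewrite fmorphV rmorphN/=; move: ((2 * cos t - 2)%:C) => c c0.
by field; rewrite zk0 c0.
Qed.

End Riesz.

(** In Riesz's formula at [u = cis t] every sample point [J (u z_k)] lies in [[-1, 1]], and the
    total weight [n^2] is divided by the factor [n] on the left. *)
Lemma bernstein_inequality (R : realType) (n : nat) (p : {poly R[i]}) (L : R) :
  (0 < n)%N -> (size p <= n.+1)%N ->
  (forall x, -1 <= x <= 1 -> normc p.[x%:C] <= L) ->
  forall t, normc p^`().[(cos t)%:C] * `|sin t| <= n%:R * L.
Proof.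
move=> n0 sp pL t; have n0' : 0 < n%:R :> R by rewrite ltr0n.
have := riesz_formula n0 sp (cis_neq0 t); rewrite joukowski_cis.
have -> : (cis t - (cis t)^-1) / 2 = (0 +i* 1) * (sin t)%:C.
  rewrite -cisN /cis cosN sinN; apply: (mulIf (x := 2)); first by rewrite pnatr_eq0.
  rewrite divfK ?pnatr_eq0// -[2](rmorph_nat (@real_complex R)).
  by apply/eqP; rewrite eq_complex/=; apply/andP; split; apply/eqP; ring.
move=> /(congr1 (@normc R)); rewrite !normcM normc_nat normc_real.
have -> : normc (0 +i* 1) = 1 :> R by rewrite /normc/= expr0n expr1n/= add0r sqrtr1.
rewrite mul1r => E; rewrite -(ler_pM2l n0') E.
apply: (le_trans (normc_sum _ _ _)).
apply: (@le_trans _ _ (n%:R ^+ 2 * L)); last by rewrite expr2 mulrA.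
rewrite -(riesz_weights R n0) mulr_suml; apply: ler_sum => k _.
rewrite [leLHS]normcM ler_wpM2l ?normc_ge0//.
by rewrite cisX -!cisD joukowski_cis; apply: pL; rewrite cos_geN1 cos_le1.
Qed.

Lemma cos_poly_lipschitz (R : realType) (n : nat) (p : {poly R[i]}) (L : R) :
  (0 < n)%N -> (size p <= n.+1)%N ->
  (forall x, -1 <= x <= 1 -> normc p.[x%:C] <= L) ->
  forall a b, normc (p.[(cos a)%:C] - p.[(cos b)%:C]) <= n%:R * L * `|a - b|.
Proof.
move=> n0 sp pL a b.
wlog ab : a b / b <= a.
  by move=> W; have [/W//|/ltW/W] := leP b a; rewrite normcBC distrC.
(* After the rotation the increment is that of the real polynomial [r], whose coefficients are the
   real parts of those of [c p]. *)
have [c c1 cE] := normc_rotation (p.[(cos a)%:C] - p.[(cos b)%:C]).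
pose r : {poly R} := map_poly (fun z => complex.Re (c * z)) p.
have Re_lin (q : {poly R[i]}) (x : R) :
    (map_poly (fun z => complex.Re (c * z)) q).[x] = complex.Re (c * q.[x%:C]).
  rewrite -[in RHS](coefK q) horner_poly mulr_sumr.
  rewrite (@horner_coef_wide _ (size q)) ?size_poly//.
  rewrite raddf_sum/=; apply: eq_bigr => i _; rewrite coef_poly ltn_ord.
  by rewrite mulrA -rmorphXn/=; case: (c * q`_i) => ? ?; rewrite /= mulr0 subr0.
have rD : r^`() = map_poly (fun z => complex.Re (c * z)) p^`().
  by apply/polyP => i; rewrite coef_deriv !coef_map_id0 ?mulr0//= coef_deriv mulrnAr raddfMn.
have D (t : R) : is_derive t 1 (fun t => r.[cos t]) (- (r^`().[cos t] * sin t)).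
  by rewrite -mulrN; exact: (is_derive1_comp (is_derive_poly r (cos t)) (is_derive_cos t)).
have [|t _ E] := MVT_segment ab (fun t _ => D t).
  apply: continuous_subspaceT => y; apply: differentiable_continuous.
  by apply/derivable1_diffP; have [] := D y.
have -> : normc (p.[(cos a)%:C] - p.[(cos b)%:C]) = r.[cos a] - r.[cos b].
  by rewrite !Re_lin -raddfB -mulrBr cE.
rewrite E (le_trans (ler_norm _))// normrM ler_wpM2r// normrN normrM.
apply: le_trans (bernstein_inequality n0 sp pL t).
by rewrite ler_wpM2r// rD Re_lin (le_trans (normc_ge_Re _))// normcM c1 mul1r.
Qed.

Lemma perturbed_lebesgue_le (R : realType) (n : nat) (p : {poly R[i]}) (e : nat -> R)
    (s E : R) : (0 < n)%N -> (size p <= n.+1)%N ->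
  (forall j, (j <= n)%N -> `|e j| <= s) ->
  n%:R * s * ((1 + 2 / pi) * (1 + ln n%:R)) < 1 ->
  (forall j, (j <= n)%N -> normc p.[(cos (j%:R * pi / n%:R + e j))%:C] <= E) ->
  forall x, -1 <= x <= 1 ->
  normc p.[x%:C] <= (1 + 2 / pi) * (1 + ln n%:R) * E /
    (1 - n%:R * s * ((1 + 2 / pi) * (1 + ln n%:R))).
Proof.
move=> n0 sp es sL1 pE x x1; set Lam := (1 + 2 / pi) * (1 + ln n%:R).
have Lam0 : 0 <= Lam.
  by rewrite mulr_ge0// addr_ge0// ?ln_ge0 ?ler1n// divr_ge0 ?pi_ge0.
pose N : set R := [set normc p.[y%:C] | y in `[-1, 1]%classic].
(* Finiteness matters: [NLam] has the supremum on both sides and is solved for it at the end. *)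
have Nub : has_sup N.
  split; first by exists (normc p.[x%:C]); exists x => //=; rewrite in_itv.
  exists (\sum_(i < size p) normc p`_i) => _ [y /= + <-]; rewrite in_itv/= => y1.
  rewrite -[in leLHS](coefK p) horner_poly (le_trans (normc_sum _ _ _))//.
  apply: ler_sum => i _; rewrite normcM normcX normc_real ler_piMr ?normc_ge0//.
  by rewrite exprn_ile1// ler_norml.
have NL y : -1 <= y <= 1 -> normc p.[y%:C] <= sup N.
  by move=> y1; apply: sup_upper_bound => //; exists y => //=; rewrite in_itv.
have NLam : sup N <= Lam * (E + n%:R * sup N * s).
  apply: ge_sup => [|_ [y /= + <-]]; first by case: Nub.
  rewrite in_itv/= => y1; apply: chebyshev_lebesgue_le => // j jn.
  rewrite -[p.[_]](subrK p.[(cos (j%:R * pi / n%:R + e j))%:C]) addrC.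
  apply: (le_trans (normcD _ _)); apply: lerD; first exact: pE.
  apply: (le_trans (cos_poly_lipschitz n0 sp NL _ _)).
  rewrite ler_wpM2l ?mulr_ge0//; first exact: (le_trans (normc_ge0 _) (NL _ x1)).
  by rewrite opprD addrA subrr add0r normrN es.
apply: (le_trans (NL _ x1)); rewrite ler_pdivlMr ?subr_gt0//.
rewrite -subr_ge0 in NLam; rewrite -subr_ge0; apply: le_trans NLam _.
by rewrite le_eqVlt; apply/orP; left; apply/eqP; ring.
Qed.

(** * Topology of the complex plane, strict differentiability *)

Lemma norm_normc (R : realType) (z : R[i]) : `|z| = (normc z)%:C.
Proof. by case: z. Qed.

(** Radii in [R[i]^o] are elements of [R[i]], but a positive one is real, so real [e] suffice. *)
Lemma cvgcP (R : realType) (T : Type) (F : set_system T) (FF : Filter F)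
    (f : T -> R[i]^o) (y : R[i]^o) :
  f @ F --> y <-> forall e : R, 0 < e -> \forall t \near F, normc (y - f t) < e.
Proof.
split=> [/cvgrPdist_lt fy e e0|fy].
  have e0' : 0 < e%:C :> R[i] by rewrite ltcR.
  by apply: filterS (fy _ e0') => t; rewrite norm_normc ltcR.
apply/cvgrPdist_lt => -[e e'] /=; rewrite ltcE/= => /andP[/eqP -> e0].
by apply: filterS (fy _ e0) => t; rewrite norm_normc ltcR.
Qed.

Lemma nbhscP (R : realType) (z : R[i]^o) (P : set R[i]^o) :
  nbhs z P <-> exists2 e : R, 0 < e & forall y, normc (z - y) < e -> P y.
Proof.
split=> [|[e e0 eP]].
  move=> /nbhs_ballP[[e e']]/=; rewrite ltcE/= => /andP[/eqP -> e0] eP.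
  by exists e => // y zy; apply: eP; rewrite -ball_normE/= norm_normc ltcR.
have /cvgcP/(_ e e0) : (id : R[i]^o -> R[i]^o) @ nbhs z --> z by exact: cvg_id.
by apply: filterS => y /eP.
Qed.

Lemma cvg_normc (R : realType) (T : Type) (F : set_system T) (FF : Filter F)
    (f : T -> R[i]^o) (y : R[i]^o) :
  f @ F --> y -> normc (f t) @[t --> F] --> normc y.
Proof.
move=> /cvgcP fy; apply/cvgrPdist_lt => e e0; apply: filterS (fy e e0) => t.
apply: le_lt_trans.
have h (a b : R[i]) : normc a - normc b <= normc (a - b).
  by rewrite lerBlDr -[X in normc X <= _](subrK b a) normcD.
by rewrite ler_norml h andbT lerNl opprB normcBC h.
Qed.

Lemma cvg_complex (R : realType) (T : Type) (F : set_system T) (FF : Filter F)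
    (a b : T -> R) (x y : R) : a @ F --> x -> b @ F --> y ->
  (a t +i* b t : R[i]^o) @[t --> F] --> (x +i* y : R[i]^o).
Proof.
move=> /cvgrPdist_lt ax /cvgrPdist_lt bx; apply/cvgcP => e e0.
have e2 : 0 < e / 2 by rewrite divr_gt0.
apply: filterS2 (ax _ e2) (bx _ e2) => t at_ bt.
have -> : (x +i* y) - (a t +i* b t) = (x - a t)%:C + (0 +i* 1) * (y - b t)%:C.
  by apply/eqP; rewrite eq_complex/=; apply/andP; split; apply/eqP; ring.
apply: le_lt_trans (normcD _ _) _; rewrite normcM !normc_real.
have -> : normc (0 +i* 1) = 1 :> R by rewrite /normc/= expr0n expr1n/= add0r sqrtr1.
by rewrite mul1r [ltRHS](splitr e) ltrD.
Qed.

(** Such a set is a closed part of a square, which is compact as the continuous image of a product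
    of two segments. *)
Lemma closed_bounded_compact (R : realType) (A : set R[i]^o) (M : R) :
  closed A -> (forall z, A z -> normc z <= M) -> compact A.
Proof.
move=> cA AM; pose B := `[- M, M]%classic : set R.
have cB : compact [set (p.1 +i* p.2 : R[i]^o) | p in B `*` B].
  apply: continuous_compact.
    apply: continuous_subspaceT => -[x y].
    by apply: cvg_complex; [exact: cvg_fst|exact: cvg_snd].
  by apply: compact_setX; exact: segment_compact.
apply: (subclosed_compact cA cB) => -[x y] /AM xyM.
exists (x, y) => //=; split; rewrite /B/= in_itv/= -ler_norml (le_trans _ xyM)//.
  exact: (normc_ge_Re (x +i* y)).
by rewrite /normc -sqrtr_sqr ler_wsqrtr// lerDr sqr_ge0.
Qed.

(* Strict differentiability, in Caratheodory's form: the difference quotient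
   is a function of two variables that is continuous at the diagonal point. *)
Definition strictly_diff (K : numFieldType) (f : K -> K) (z : K) :=
  exists2 Phi : K * K -> K,
    {for (z, z), continuous Phi} &
    \forall y \near (z, z), f y.1 - f y.2 = Phi y * (y.1 - y.2).

Lemma near_diag (K : numFieldType) (z : K) (P : set K) :
  (\forall y \near z, P y) -> \forall y \near (z, z), P y.1 /\ P y.2.
Proof.
by move=> zP; exists (P, P) => //= -[a b].
Qed.

Lemma strictly_diff_continuous (K : numFieldType) (f : K -> K) z :
  strictly_diff f z -> {for z, continuous f}.
Proof.
move=> [Phi cPhi fPhi].
have cz : {for z, continuous (fun y => (y, z))}.
  move=> P [[A B] [/= zA zB] AB]; apply: filterS zA => y Ay; apply: AB.
  by split => //; exact: nbhs_singleton zB.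
have cid : {for z, continuous (fun y : K => y)} by exact: cvg_id.
have ccst (c : K) : {for z, continuous (fun _ : K => c)} by exact: cst_continuous.
have cp : {for z, continuous (fun y => f z + Phi (y, z) * (y - z))}.
  apply: (continuousD (ccst (f z))); apply: continuousM.
    exact: (continuous_comp cz cPhi).
  exact: (continuousB cid (ccst z)).
have E : f z = f z + Phi (z, z) * (z - z) by rewrite subrr mulr0 addr0.
have eqf : \forall y \near z, f z + Phi (y, z) * (y - z) = f y.
  have h : \forall y \near z, f y - f z = Phi (y, z) * (y - z) by exact: cz _ fPhi.
  by near=> y; rewrite -(near h y)// addrC subrK.
by rewrite /prop_for /continuous_at E; apply: cvg_trans cp; exact: near_eq_cvg eqf.
Unshelve. all: by end_near. Qed.

Lemma strictly_diff_ext (K : numFieldType) (f g : K -> K) z :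
  (\forall y \near z, f y = g y) -> strictly_diff f z -> strictly_diff g z.
Proof.
move=> /near_diag fg [Phi cPhi fPhi]; exists Phi => //.
near=> y.
have [<- <-] : f y.1 = g y.1 /\ f y.2 = g y.2 by near: y.
by near: y.
Unshelve. all: by end_near. Qed.

Lemma strictly_diff_id (K : numFieldType) (z : K) : strictly_diff id z.
Proof.
exists (cst 1); first exact: cst_continuous.
by near=> y; rewrite /= mul1r.
Unshelve. all: by end_near. Qed.

Lemma strictly_diff_cst (K : numFieldType) (c z : K) : strictly_diff (cst c) z.
Proof.
exists (cst 0); first exact: cst_continuous.
by near=> y; rewrite /= mul0r subrr.
Unshelve. all: by end_near. Qed.

Lemma strictly_diffD (K : numFieldType) (f g : K -> K) z :
  strictly_diff f z -> strictly_diff g z -> strictly_diff (fun y => f y + g y) z.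
Proof.
move=> [Phi cPhi fPhi] [Psi cPsi gPsi]; exists (fun y => Phi y + Psi y).
  exact: (continuousD cPhi cPsi).
near=> y.
have e1 : f y.1 - f y.2 = Phi y * (y.1 - y.2) by near: y.
have e2 : g y.1 - g y.2 = Psi y * (y.1 - y.2) by near: y.
by rewrite mulrDl -e1// -e2// opprD addrACA.
Unshelve. all: by end_near. Qed.

Lemma strictly_diffM (K : numFieldType) (f g : K -> K) z :
  strictly_diff f z -> strictly_diff g z -> strictly_diff (fun y => f y * g y) z.
Proof.
move=> df dg; have cf := strictly_diff_continuous df; have cg := strictly_diff_continuous dg.
case: df dg => [Phi cPhi fPhi] [Psi cPsi gPsi].
exists (fun y => Phi y * g y.1 + f y.2 * Psi y).
  have p1 : {for (z, z), continuous (fun y : K * K => y.1)} by exact: cvg_fst.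
  have p2 : {for (z, z), continuous (fun y : K * K => y.2)} by exact: cvg_snd.
  have c1 : {for (z, z), continuous (fun y : K * K => g y.1)} := continuous_comp p1 cg.
  have c2 : {for (z, z), continuous (fun y : K * K => f y.2)} := continuous_comp p2 cf.
  exact: (continuousD (continuousM cPhi c1) (continuousM c2 cPsi)).
near=> y.
have e1 : f y.1 - f y.2 = Phi y * (y.1 - y.2) by near: y.
have e2 : g y.1 - g y.2 = Psi y * (y.1 - y.2) by near: y.
have -> : (Phi y * g y.1 + f y.2 * Psi y) * (y.1 - y.2) =
  (Phi y * (y.1 - y.2)) * g y.1 + f y.2 * (Psi y * (y.1 - y.2)) by ring.
by rewrite -e1// -e2//; ring.
Unshelve. all: by end_near. Qed.

Lemma strictly_diff_comp (K : numFieldType) (f g : K -> K) z :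
  strictly_diff f z -> strictly_diff g (f z) -> strictly_diff (fun y => g (f y)) z.
Proof.
move=> df; have cf := strictly_diff_continuous df.
case: df => [Phi cPhi fPhi] [Psi cPsi gPsi].
have cff : {for (z, z), continuous (fun y : K * K => (f y.1, f y.2))}.
  move=> P [[A B] [/= zA zB] AB]; exists (f @^-1` A, f @^-1` B).
    by split; exact: cf.
  by move=> [a b] [/= fa fb]; exact: AB.
exists (fun y => Psi (f y.1, f y.2) * Phi y).
  have c1 : {for (z, z), continuous (fun y : K * K => Psi (f y.1, f y.2))}.
    exact: (continuous_comp cff cPsi).
  exact: (continuousM c1 cPhi).
have gf : \forall y \near (z, z),
    g (f y.1) - g (f y.2) = Psi (f y.1, f y.2) * (f y.1 - f y.2) by exact: cff _ gPsi.
near=> y.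
have e1 : f y.1 - f y.2 = Phi y * (y.1 - y.2) by near: y.
have e2 : g (f y.1) - g (f y.2) = Psi (f y.1, f y.2) * (f y.1 - f y.2) by near: y.
by rewrite e2// e1// mulrA.
Unshelve. all: by end_near. Qed.

Lemma strictly_diffV (K : numFieldType) (z : K) : z != 0 ->
  strictly_diff (fun y => y^-1) z.
Proof.
move=> z0; exists (fun y => - (y.1^-1 * y.2^-1)).
  have c1 : {for (z, z), continuous (fun y : K * K => y.1)} by exact: cvg_fst.
  have c2 : {for (z, z), continuous (fun y : K * K => y.2)} by exact: cvg_snd.
  exact: (continuousN (continuousM (continuousV z0 c1) (continuousV z0 c2))).
have : \forall y \near z, y != 0.
  apply/nbhs_normP; exists `|z|; rewrite /= ?normr_gt0// => y /=.
  by apply: contraTneq => ->; rewrite subr0 ltxx.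
move=> /near_diag zn0; near=> y; have [a0 b0] : y.1 != 0 /\ y.2 != 0 by near: y.
by field; rewrite a0 b0.
Unshelve. all: by end_near. Qed.

(** * Power series *)

Lemma cvgcnP (R : realType) (u : nat -> R[i]^o) (l : R[i]^o) :
  u @ \oo --> l <->
  forall e : R, 0 < e -> exists N, forall n, (N <= n)%N -> normc (l - u n) < e.
Proof.
split=> [/cvgcP ul e e0|ul]; first by have [N _ NP] := ul e e0; exists N.
by apply/cvgcP => e /ul[N NP]; exists N.
Qed.

Lemma cvgc_normc_le (R : realType) (u : nat -> R[i]^o) (l : R[i]^o) (C : R) :
  u @ \oo --> l -> (forall n, normc (u n) <= C) -> normc l <= C.
Proof.
move=> /cvgcnP ul uC; apply/ler_addgt0Pr => e e0; have [N NP] := ul e e0.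
rewrite -[X in normc X](subrK (u N)) addrC (le_trans (normcD _ _))// lerD//.
exact/ltW/NP.
Qed.

Lemma normc_subX (R : realType) (h k : R[i]) (d : R) n :
  normc h <= d -> normc k <= d ->
  normc (h ^+ n.+1 - k ^+ n.+1) <= n.+1%:R * d ^+ n * normc (h - k).
Proof.
move=> hd kd; have d0 : 0 <= d by exact: le_trans (normc_ge0 _) hd.
elim: n => [|n ih]; first by rewrite !expr1 expr0 !mul1r.
have -> : h ^+ n.+2 - k ^+ n.+2 = h * (h ^+ n.+1 - k ^+ n.+1) + k ^+ n.+1 * (h - k).
  by rewrite [h ^+ n.+2]exprS [k ^+ n.+2]exprSr; ring.
apply: le_trans (normcD _ _) _; rewrite !normcM normcX.
have -> : n.+2%:R * d ^+ n.+1 * normc (h - k) =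
    d * (n.+1%:R * d ^+ n * normc (h - k)) + d ^+ n.+1 * normc (h - k).
  by rewrite -[n.+2%:R]natr1 exprS; ring.
apply: lerD; first by apply: ler_pM => //; exact: normc_ge0.
by rewrite ler_wpM2r ?normc_ge0// lerXn2r// nnegrE ?normc_ge0.
Qed.

(** The term of index [i + 2] is at most [(i + 2) d^(i+1) B / s^(i+2)] times [|h - k|]. With
    [i + 2 <= 2^(i+1)] and [d <= s / 4] these bounds are dominated by a geometric series of ratio
    [1/2]. *)
Lemma power_series_increment (R : realType) (a : nat -> R[i]) (B s d : R) (h k : R[i]) n :
  0 < s -> (forall j, normc (a j) * s ^+ j <= B) -> d <= s / 4 ->
  normc h <= d -> normc k <= d ->
  normc (\sum_(0 <= j < n.+2) a j * (h ^+ j - k ^+ j) - a 1%N * (h - k)) <=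
  4 * B / s ^+ 2 * d * normc (h - k).
Proof.
move=> s0 aB ds hd kd; have d0 : 0 <= d by exact: le_trans (normc_ge0 _) hd.
have B0 : 0 <= B by apply: le_trans (aB 0%N); rewrite expr0 mulr1 normc_ge0.
rewrite big_nat_recl// big_nat_recl// !expr0 subrr mulr0 add0r !expr1 addrC addrA.
rewrite [- _ + _]addrC subrr add0r; apply: le_trans (normc_sum _ _ _) _.
pose c := 2 * (B / s) * (d / s) * normc (h - k).
have c0 : 0 <= c by rewrite !mulr_ge0 ?normc_ge0 ?invr_ge0 ?(ltW s0).
apply: (@le_trans _ _ (\sum_(0 <= i < n) c * 2^-1 ^+ i)).
  apply: ler_sum => i _; rewrite normcM.
  have ai : normc (a i.+2) <= B / s ^+ i.+2 by rewrite ler_pdivlMr ?exprn_gt0.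
  apply: (@le_trans _ _ (B / s ^+ i.+2 * (2 ^+ i.+1 * d ^+ i.+1 * normc (h - k)))).
    apply: ler_pM; rewrite ?normc_ge0//.
    apply: le_trans (normc_subX i.+1 hd kd) _.
    rewrite ler_wpM2r ?normc_ge0// ler_wpM2r ?exprn_ge0// -natrX ler_nat.
    exact: ltn_expl.
  have q : (2 * (d / s)) ^+ i <= 2^-1 ^+ i.
    rewrite lerXn2r// ?nnegrE ?mulr_ge0 ?invr_ge0 ?divr_ge0 ?(ltW s0)//.
    by rewrite mulrA ler_pdivrMr//; lra.
  have -> : B / s ^+ i.+2 * (2 ^+ i.+1 * d ^+ i.+1 * normc (h - k)) =
      c * (2 * (d / s)) ^+ i.
    by rewrite /c exprMn expr_div_n !exprS; field; rewrite expf_neq0 ?gt_eqF.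
  by rewrite ler_wpM2l.
rewrite -mulr_sumr; have -> : 4 * B / s ^+ 2 * d * normc (h - k) = c * 2.
  by rewrite /c; field; rewrite gt_eqF.
rewrite ler_wpM2l//.
rewrite big_mkord; have := subrX1 (2^-1 : R) n => e.
have -> : \sum_(i < n) 2^-1 ^+ i = 2 * (1 - 2^-1 ^+ n) :> R.
  have e2 : (2^-1 - 1 : R) = - 2^-1 by lra.
  rewrite e2 in e; apply: (mulfI (x := - 2^-1)); first by rewrite oppr_eq0 invr_eq0 pnatr_eq0.
  by rewrite -e; field.
have : 0 <= 2^-1 ^+ n :> R by rewrite exprn_ge0.
by lra.
Qed.

(** Half the radius of the neighbourhood is taken for [s], so that the series converges at [h = s]
    itself. Its terms tend to 0 there, and the bound adds the finitely many early ones to 1. *)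
Lemma analytic_coef_bound (R : realType) (f : R[i]^o -> R[i]^o) (z0 : R[i]^o) :
  analytic_at f z0 -> exists a : nat -> R[i]^o, exists s B : R,
    [/\ 0 < s, forall j, normc (a j) * s ^+ j <= B & forall h : R[i]^o, normc h <= s ->
      series (fun k => a k * h ^+ k) @ \oo --> f (z0 + h)].
Proof.
move=> [a /nbhscP[e e0 ea]]; exists a, (e / 2).
have conv (h : R[i]^o) : normc h <= e / 2 -> series (fun k => a k * h ^+ k) @ \oo --> f (z0 + h).
  move=> he; have := ea (z0 + h); rewrite [z0 + h - z0]addrC addKr; apply.
  by rewrite opprD addrA subrr add0r normcNE (le_lt_trans he)// ltr_pdivrMr// ltr_pMr// ltr1n.
have e2 : 0 < e / 2 by rewrite divr_gt0.
have ns : normc (e / 2)%:C = e / 2 by rewrite normc_real gtr0_norm.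
have /cvgcnP/(_ 1 ltr01)[N NP] : (fun k => a k * (e / 2)%:C ^+ k) @ \oo --> (0 : R[i]^o).
  apply: (@cvg_series_cvg_0 R[i] R[i]^o).
  by apply/cvg_ex; exists (f (z0 + (e / 2)%:C)); apply: conv; rewrite ns.
exists (1 + \sum_(0 <= k < N) normc (a k) * (e / 2) ^+ k); split=> // j.
have tE : normc (a j) * (e / 2) ^+ j = normc (a j * (e / 2)%:C ^+ j).
  by rewrite normcM normcX ns.
have t0 k : 0 <= normc (a k) * (e / 2) ^+ k.
  by rewrite mulr_ge0 ?normc_ge0 ?exprn_ge0// ltW.
have [Nj|jN] := leqP N j.
  have := NP j Nj; rewrite sub0r normcNE -tE => /ltW/le_trans; apply.
  by rewrite lerDl sumr_ge0.
rewrite big_mkord (bigD1 (Ordinal jN))//= addrCA lerDl addr_ge0//.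
by rewrite sumr_ge0.
Qed.

(** The difference quotient, set to [a 1] on the diagonal, stays within [C d] of [a 1] when both
    points are within [d <= s / 4] of [z0]; the estimate passes from the partial sums to the
    limit. *)
Lemma analytic_strictly_diff (R : realType) (f : R[i]^o -> R[i]^o) (z0 : R[i]^o) :
  analytic_at f z0 -> @strictly_diff R[i] f z0.
Proof.
move=> /analytic_coef_bound[a [s [B [s0 aB conv]]]].
pose Phi (y : R[i] * R[i]) : R[i] :=
  if y.1 == y.2 then a 1%N else (f y.1 - f y.2) / (y.1 - y.2).
exists Phi; last first.
  near=> y; rewrite /Phi; case: eqVneq => [->|y12]; first by rewrite !subrr mulr0.
  by rewrite divfK// subr_eq0.
have B0 : 0 <= B by apply: le_trans (aB 0%N); rewrite expr0 mulr1 normc_ge0.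
pose C := 4 * B / s ^+ 2.
have C0 : 0 <= C by apply: divr_ge0 (sqr_ge0 s); apply: mulr_ge0.
have main (d : R) (h k : R[i]) : 0 < d -> d <= s / 4 -> normc h <= d -> normc k <= d ->
    normc (f (z0 + h) - f (z0 + k) - a 1%N * (h - k)) <= C * d * normc (h - k).
  move=> d0 ds hd kd.
  have s4 : s / 4 <= s by rewrite ler_pdivrMr//; lra.
  have hs : normc h <= s by rewrite (le_trans hd)// (le_trans ds).
  have ks : normc k <= s by rewrite (le_trans kd)// (le_trans ds).
  apply: (@cvgc_normc_le _ (fun n => \sum_(0 <= j < n.+2) a j * (h ^+ j - k ^+ j) - a 1%N * (h - k))).
    apply/cvgcnP => e e0; have e2 : 0 < e / 2 by rewrite divr_gt0.
    have /cvgcnP/(_ _ e2)[N1 NP1] := conv h hs; have /cvgcnP/(_ _ e2)[N2 NP2] := conv k ks.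
    exists (N1 + N2)%N => n Nn.
    have n1 : (N1 <= n.+2)%N by rewrite !leqW// (leq_trans (leq_addr _ _) Nn).
    have n2 : (N2 <= n.+2)%N by rewrite !leqW// (leq_trans (leq_addl _ _) Nn).
    have -> : f (z0 + h) - f (z0 + k) - a 1%N * (h - k) -
      (\sum_(0 <= j < n.+2) a j * (h ^+ j - k ^+ j) - a 1%N * (h - k)) =
      (f (z0 + h) - series (fun j => a j * h ^+ j) n.+2) -
      (f (z0 + k) - series (fun j => a j * k ^+ j) n.+2).
      under eq_bigr do rewrite mulrBr.
      by rewrite sumrB /series/=; ring.
    apply: le_lt_trans (normcB _ _) _; rewrite [ltRHS](splitr e).
    by rewrite ltrD ?NP1 ?NP2.
  by move=> n; apply: power_series_increment.
apply/(@cvgcP _ _ (nbhs ((z0 : R[i]^o), (z0 : R[i]^o))) _ (Phi : _ -> R[i]^o)) => e e0.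
pose d := Num.min (s / 4) (e / 2 / (C + 1)).
have C1 : 0 < C + 1 by rewrite ltr_pwDr.
have d0 : 0 < d by rewrite lt_min !divr_gt0.
have ds : d <= s / 4 by rewrite ge_min lexx.
have de : C * d < e.
  apply: (@le_lt_trans _ _ (e / 2)); last by rewrite ltr_pdivrMr// ltr_pMr// ltr1n.
  have : d <= e / 2 / (C + 1) by rewrite ge_min lexx orbT.
  by rewrite ler_pdivlMr//; apply: le_trans; rewrite mulrC ler_wpM2l ?(ltW d0)// lerDl.
pose P : set R[i]^o := [set y | normc (z0 - y) < d].
have nP : nbhs (z0 : R[i]^o) P by apply/nbhscP; exists d.
exists (P, P) => //= -[y y'] [/= yd yd']; rewrite {1}/Phi/= eqxx.
rewrite /Phi/=; case: eqVneq => [_|yy']; first by rewrite subrr normc0.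
have yy0 : y - y' != 0 by rewrite subr_eq0.
have nyy0 : 0 < normc (y - y') by rewrite normc_gt0.
have -> : a 1%N - (f y - f y') / (y - y') = - ((f y - f y' - a 1%N * (y - y')) / (y - y')).
  by rewrite [in RHS]mulrBl mulfK// opprB.
rewrite normcNE normcM normcV ltr_pdivrMr//.
apply: (@le_lt_trans _ _ (C * d * normc (y - y'))); last by rewrite ltr_pM2r.
have := main d (y - z0) (y' - z0) d0 ds.
rewrite [z0 + _]addrC subrK [z0 + _]addrC subrK opprB addrA subrK; apply.
  by rewrite normcBC ltW.
by rewrite normcBC ltW.
Unshelve. all: by end_near. Qed.

(** Shifting the coefficients by one divides [f - f x] by [z - x], so the singularity at [x] is
    removable, with [D = a 1]. *)
Lemma analytic_difference_quotient (R : realType) (f : R[i]^o -> R[i]^o) (x : R[i]^o) :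
  analytic_at f x -> exists D : R[i],
    analytic_at (fun z => if z == x then D else (f z - f x) / (z - x)) x.
Proof.
move=> [a /nbhscP[e e0 ea]]; exists (a 1%N), (fun k => a k.+1).
have fx : f x = a 0%N.
  have /cvgcnP c : series (fun k => a k * (x - x) ^+ k) @ \oo --> f x.
    by apply: ea; rewrite subrr normc0.
  apply/eqP; rewrite -subr_eq0 -normc_eq0 eq_le normc_ge0 andbT.
  apply/ler_addgt0Pr => r r0; rewrite add0r; have [N NP] := c r r0.
  apply/ltW; have := NP N.+1 (leqW (leqnn _)).
  by rewrite /series/= big_nat_recl// big1 ?expr0 ?mulr1 ?addr0// => i _; rewrite subrr expr0n mulr0.
apply: (proj2 (nbhscP x _)).
exists e; first exact: e0.
move=> z zx.
have c := ea z zx.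
case: eqVneq => [->|zx0].
  apply/cvgcnP => r r0; exists 1%N => -[//|n] _.
  rewrite /series/= big_nat_recl// big1 ?expr0 ?mulr1 ?addr0 ?subrr ?normc0// => i _.
  by rewrite ?subrr expr0n mulr0.
have h0 : z - x != 0 by rewrite subr_eq0.
have nh0 : 0 < normc (z - x) by rewrite normc_gt0.
apply/cvgcnP => r r0; move/cvgcnP: c => /(_ (r * normc (z - x))).
rewrite mulr_gt0// => /(_ isT)[N NP]; exists N => n Nn.
have := NP n.+1 (leqW Nn); rewrite -ltr_pdivrMr// -normcV -normcM.
congr (normc _ < _); rewrite /series/= big_nat_recl// expr0 mulr1 -fx.
have -> : \sum_(0 <= i < n) a i.+1 * (z - x) ^+ i.+1 =
    (z - x) * \sum_(0 <= i < n) a i.+1 * (z - x) ^+ i.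
  by rewrite mulr_sumr; apply: eq_bigr => i _; rewrite exprS mulrCA.
by rewrite opprD addrA mulrBl [(z - x) * _]mulrC mulfK.
Qed.

(** * Discrete Cauchy theorem *)

Lemma bernoulli_le (R : realType) (x : R) n : 0 <= x -> 1 + n%:R * x <= (1 + x) ^+ n.
Proof.
move=> x0; elim: n => [|n ih]; first by rewrite mul0r addr0 expr0.
rewrite exprS; apply: (@le_trans _ _ ((1 + x) * (1 + n%:R * x))).
  have -> : (1 + x) * (1 + n%:R * x) = 1 + n.+1%:R * x + n%:R * x ^+ 2.
    by rewrite -[n.+1%:R]natr1; ring.
  by rewrite lerDl mulr_ge0// sqr_ge0.
by rewrite ler_wpM2l// addr_ge0.
Qed.

Lemma normc_cis_sub1_le (R : realType) (t : R) : 0 <= t <= pi *+ 2 -> normc (cis t - 1) <= t.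
Proof.
move=> /andP[t0 tpi]; have t20 : 0 <= t / 2 by rewrite divr_ge0.
rewrite normc_cis_sub1 ger0_norm; last first.
  by rewrite sin_ge0_pi// t20/= ler_pdivrMr// mulr_natr.
by rewrite mulrC -ler_pdivlMr// sin_le_id.
Qed.

Definition root_step (R : realType) (N : nat) : R[i] := cis (pi *+ 2 / N%:R).

Definition radial_step (R : realType) (r : R) (N : nat) : R := expR (ln r / N%:R).

Lemma root_stepX (R : realType) N : (0 < N)%N -> root_step R N ^+ N = 1.
Proof. by move=> N0; rewrite cisX mulrC divfK ?cis_2pi// pnatr_eq0 -lt0n. Qed.

Lemma normc_root_stepX (R : realType) N k : normc (root_step R N ^+ k) = 1.
Proof. by rewrite normcX normc_cis expr1n. Qed.

Lemma radial_stepX (R : realType) (r : R) N : 0 < r -> (0 < N)%N -> radial_step r N ^+ N = r.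
Proof.
move=> r0 N0; rewrite -expRM_natl mulrC divfK ?pnatr_eq0 -?lt0n//.
by rewrite lnK.
Qed.

Lemma radial_step_gt1 (R : realType) (r : R) N : 1 < r -> (0 < N)%N -> 1 < radial_step r N.
Proof. by move=> r1 N0; rewrite expR_gt1 divr_gt0 ?ln_gt0 ?ltr0n. Qed.

Lemma steps_near1 (R : realType) (r d : R) : 1 < r -> 0 < d ->
  exists2 N0, (1 < N0)%N & forall N, (N0 <= N)%N ->
    radial_step r N - 1 < d /\ normc (root_step R N - 1) < d.
Proof.
move=> r1 d0; have r0 : 0 < r by exact: lt_trans r1.
pose N0 := (Num.truncn (r / d)).+1; pose N1 := (Num.truncn (pi *+ 2 / d)).+1.
exists (maxn 2 (maxn N0 N1)); first by rewrite leq_max.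
move=> N; rewrite !geq_max => /and3P[N2 NN0 NN1].
have Np : (0 < N)%N by exact: ltnW.
have Np' : 0 < N%:R :> R by rewrite ltr0n.
have rN : r / d < N%:R by apply: lt_le_trans (truncnS_gt _) _; rewrite ler_nat.
have pN : pi *+ 2 / d < N%:R by apply: lt_le_trans (truncnS_gt _) _; rewrite ler_nat.
split.
  rewrite ltrBlDl ltNge; apply/negP => h.
  (* If the step were at least [1 + d], its [N]-th power [r] would be at least [1 + N d > r]. *)
  have := bernoulli_le N (ltW d0); rewrite leNgt => /negP; apply.
  apply: (@le_lt_trans _ _ r).
    rewrite -[leRHS](radial_stepX r0 Np) lerXn2r// ?nnegrE ?addr_ge0 ?(ltW d0)//.
    exact: expR_ge0.
  by rewrite ltr_pdivrMr// in rN; rewrite (lt_le_trans rN)// lerDr.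
have p2 : 0 < pi *+ 2 :> R by rewrite mulrn_wgt0 ?pi_gt0.
apply: (@le_lt_trans _ _ (pi *+ 2 / N%:R)).
  apply: normc_cis_sub1_le; rewrite divr_ge0 ?(ltW p2)//= ler_pdivrMr//.
  by rewrite ler_peMr ?(ltW p2)// ler1n.
by rewrite ltr_pdivrMr// mulrC -ltr_pdivrMr.
Qed.

Lemma sum_root_step_shift (R : realType) (V : zmodType) N (H : R[i] -> V) : (0 < N)%N ->
  \sum_(b < N) H (root_step R N ^+ b.+1) = \sum_(b < N) H (root_step R N ^+ b).
Proof.
by case: N => // N _; rewrite big_ord_recr [RHS]big_ord_recl addrC root_stepX.
Qed.

Lemma sum_root_step_inv (R : realType) (V : zmodType) N (H : R[i] -> V) : (0 < N)%N ->
  \sum_(b < N) H (root_step R N ^- b) = \sum_(b < N) H (root_step R N ^+ b).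
Proof.
move=> N0; rewrite -(sum_root_step_shift _ N0) [RHS](reindex_inj rev_ord_inj)/=.
apply: eq_bigr => b _; congr H; have bN := ltn_ord b.
have w0 : root_step R N ^+ b != 0 by rewrite expf_neq0// cis_neq0.
apply: (mulfI w0); rewrite mulfV// -exprD subnSK// subnKC ?root_stepX//.
exact: ltnW.
Qed.

(* A discrete Cauchy-Riemann equation. *)
Lemma discrete_cauchy_riemann (R : realType) (G : R[i]^o -> R[i]^o) (r e : R) :
  1 < r -> (forall z : R[i]^o, 1 <= normc z <= r -> @strictly_diff R[i] G z) -> 0 < e ->
  exists2 N0, (1 < N0)%N & forall N, (N0 <= N)%N -> forall y : R[i]^o, 1 <= normc y <= r ->
  normc (G ((radial_step r N)%:C * y) - G y - ((radial_step r N)%:C - 1) / (root_step R N - 1) *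
      (G (root_step R N * y) - G y)) <= e * (radial_step r N - 1) * normc y.
Proof.
move=> r1 dG e0.
pose A : set R[i]^o := [set y | 1 <= normc y <= r].
have cA : compact A.
  apply: (@closed_bounded_compact _ _ r); last by move=> z /andP[].
  have -> : A = (fun y : R[i]^o => normc y) @^-1` `[1, r] by apply/seteqP; split => y /=; rewrite in_itv.
  apply: closed_comp => [y _|]; last exact: itv_closed.
  by apply: (@cvg_normc R _ (nbhs y) _ id y); exact: cvg_id.
pose P (N : nat) (y : R[i]^o) := normc (G ((radial_step r N)%:C * y) - G y -
  ((radial_step r N)%:C - 1) / (root_step R N - 1) * (G (root_step R N * y) - G y)) <=
  e * (radial_step r N - 1) * normc y.
(* Compactness makes the threshold on [N] uniform in [y]: it remains to find, near each [z], one
   threshold valid for all nearby [y]. *)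
have /compact_near_coveringP/(_ nat \oo P _) := cA.
have local z : A z -> \forall y \near z & N \near \oo, P N y.
  move=> Az; have [Phi cPhi GPhi] := dG z Az.
  have e2 : 0 < e / 2 by rewrite divr_gt0.
  have [d d0 dP] : exists2 d : R, 0 < d & forall a b : R[i], normc (z - a) < d -> normc (z - b) < d ->
      G a - G b = Phi (a, b) * (a - b) /\ normc (Phi (z, z) - Phi (a, b)) < e / 2.
    have := proj1 (@cvgcP R _ (nbhs ((z, z) : R[i]^o * R[i]^o)) _ Phi (Phi (z, z))) cPhi _ e2.
    move: GPhi => -[[A1 B1] [/= /nbhscP[a1 a10 h1] /nbhscP[b1 b10 k1]] G1].
    move=> -[[A2 B2] [/= /nbhscP[a2 a20 h2] /nbhscP[b2 b20 k2]] G2].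
    exists (Num.min (Num.min a1 b1) (Num.min a2 b2)); first by rewrite !lt_min a10 b10 a20 b20.
    move=> a b; rewrite !lt_min => /andP[/andP[za1 _] /andP[za2 _]] /andP[/andP[_ zb1] /andP[_ zb2]].
    by split; [apply: (G1 (a, b))|apply: (G2 (a, b))]; split => /=; auto.
  have d2 : 0 < d / 2 by rewrite divr_gt0.
  have M0 : 0 < normc z + d by rewrite ltr_wpDl ?normc_ge0.
  (* With this tolerance, multiplying [y] by a step moves it by at most [d / 2], as
     [|y| <= |z| + d]. *)
  have [N0 N01 NP] := steps_near1 r1 (divr_gt0 d2 M0).
  exists ([set y | normc (z - y) < d / 2], [set N | (N0 <= N)%N]).
    split; first by apply: (proj2 (nbhscP z _)); exists (d / 2).
    by exists N0.
  move=> -[y N] [/= zy /[dup] N0N /NP[qd wd]]; rewrite /P.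
  have Np : (1 < N)%N by exact: leq_trans N0N.
  set q := radial_step r N in qd *; set w := root_step R N in wd *.
  have q1 : 0 < q - 1 by rewrite subr_gt0 radial_step_gt1// ltnW.
  have w1 : w - 1 != 0.
    have p2 : 0 < pi *+ 2 :> R by rewrite mulrn_wgt0 ?pi_gt0.
    rewrite cis_sub1_neq0// divr_gt0 ?ltr0n ?(ltnW Np)//=.
    by rewrite ltr_pdivrMr ?ltr0n ?(ltnW Np)// ltr_pMr// ltr1n.
  have yM : normc y <= normc z + d.
    rewrite -[y](subKr z) (le_trans (normcB _ _))// lerD2l (le_trans (ltW zy))//.
    by rewrite ler_pdivrMr// ler_pMr// ler1n.
  have near_y (v : R[i]) : normc (v - 1) < d / 2 / (normc z + d) -> normc (z - v * y) < d.
    move=> vd; have -> : z - v * y = (z - y) - (v - 1) * y by ring.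
    apply: le_lt_trans (normcB _ _) _; rewrite [ltRHS](splitr d) ltr_leD// normcM.
    rewrite -[leRHS](divfK (lt0r_neq0 M0)); apply: ler_pM; rewrite ?normc_ge0//.
    exact: ltW.
  have qC : normc (q%:C - 1) = q - 1.
    by rewrite -[X in _ - X](rmorph1 (@real_complex R)) -rmorphB normc_real gtr0_norm.
  have zy' : normc (z - y) < d by rewrite (lt_le_trans zy)// ler_pdivrMr// ler_pMr// ler1n.
  have zq : normc (z - q%:C * y) < d by apply: near_y; rewrite qC.
  have [E1 F1] := dP _ _ zq zy'; have [E2 F2] := dP _ _ (near_y _ wd) zy'.
  (* Both increments have slopes close to [Phi (z, z)], which cancels in the difference. *)
  rewrite E1 E2; have -> : Phi (q%:C * y, y) * (q%:C * y - y) -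
      (q%:C - 1) / (w - 1) * (Phi (w * y, y) * (w * y - y)) =
      (q%:C - 1) * y * ((Phi (z, z) - Phi (w * y, y)) - (Phi (z, z) - Phi (q%:C * y, y))).
    by field.
  rewrite !normcM qC; have -> : e * (q - 1) * normc y = (q - 1) * normc y * e by ring.
  rewrite ler_wpM2l ?mulr_ge0 ?normc_ge0 ?(ltW q1)//.
  apply: le_trans (normcB _ _) _.
  by rewrite [leRHS](splitr e) lerD// ltW.
move=> /(_ local)[N0 _ NP]; exists (maxn 2 N0); first by rewrite leq_max.
by move=> N; rewrite geq_max => /andP[_ N0N] y Ay; exact: NP.
Qed.

(** The radii [q^a], [a = 0, ..., N], with [q^N = r] lead from the unit circle to the circle of
    radius [r]; the discrete Cauchy-Riemann equation bounds the change of the sum from each radius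
    to the next. *)
Lemma discrete_cauchy (R : realType) (G : R[i]^o -> R[i]^o) (r e : R) :
  1 < r -> (forall z : R[i]^o, 1 <= normc z <= r -> @strictly_diff R[i] G z) -> 0 < e ->
  exists2 N0, (1 < N0)%N & forall N, (N0 <= N)%N ->
  normc ((\sum_(b < N) G (r%:C * root_step R N ^+ b) - \sum_(b < N) G (root_step R N ^+ b)) / N%:R)
    <= e.
Proof.
move=> r1 dG e0; have r10 : 0 < r - 1 by rewrite subr_gt0.
have [N0 N01 NP] := discrete_cauchy_riemann r1 dG (divr_gt0 e0 r10).
exists N0 => // N NN0; have Np : (0 < N)%N by rewrite (leq_trans _ NN0)// ltnW.
have Np' : 0 < N%:R :> R by rewrite ltr0n.
rewrite normcM normcV normc_nat ler_pdivrMr//.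
set w := root_step R N; pose q := radial_step r N.
have q1 : 1 < q by exact: radial_step_gt1.
have q0 : 0 <= q by rewrite (le_trans _ (ltW q1)).
pose S a := \sum_(b < N) G ((q ^+ a)%:C * w ^+ b).
have -> : \sum_(b < N) G (r%:C * w ^+ b) = S N.
  by rewrite /S radial_stepX// (lt_trans _ r1).
have -> : \sum_(b < N) G (w ^+ b) = S 0%N.
  by apply: eq_bigr => b _; rewrite expr0 mul1r.
rewrite -(telescope_sumr S (leq0n N)).
apply: le_trans (normc_sum _ _ _) _.
(* The weights [(q - 1) q^a] add up to [q^N - 1 = r - 1]. *)
have -> : e * N%:R = \sum_(0 <= a < N) e / (r - 1) * (q - 1) * q ^+ a * N%:R.
  have Sq := subrX1 q N; rewrite radial_stepX ?(lt_trans _ r1)// in Sq.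
  by rewrite -mulr_suml -mulr_sumr big_mkord -[_ * (q - 1) * _]mulrA -Sq divfK ?gt_eqF.
rewrite !big_mkord; apply: ler_sum => a _.
have qa b : 1 <= normc ((q ^+ a)%:C * w ^+ b) <= r.
  rewrite normcM normc_real normc_root_stepX mulr1 ger0_norm ?exprn_ge0//.
  rewrite exprn_ege1 ?(ltW q1)//= -[leRHS](radial_stepX (lt_trans ltr01 r1) Np).
  by rewrite ler_weXn2l ?(ltW q1)// ltnW.
(* The angular increments add up to 0 around the polygon, so any multiple of them may be
   subtracted. *)
have -> : S a.+1 - S a = \sum_(b < N) (G (q%:C * ((q ^+ a)%:C * w ^+ b)) - G ((q ^+ a)%:C * w ^+ b) -
   (q%:C - 1) / (w - 1) * (G (w * ((q ^+ a)%:C * w ^+ b)) - G ((q ^+ a)%:C * w ^+ b))).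
  rewrite sumrB -mulr_sumr; have -> : \sum_(b < N) (G (w * ((q ^+ a)%:C * w ^+ b)) -
      G ((q ^+ a)%:C * w ^+ b)) = 0.
    rewrite sumrB; apply/eqP; rewrite subr_eq0; apply/eqP.
    rewrite -(sum_root_step_shift (fun v => G ((q ^+ a)%:C * v)) Np).
    by apply: eq_bigr => b _; congr G; rewrite mulrCA -exprS.
  rewrite mulr0 subr0 sumrB; congr (_ - _); apply: eq_bigr => b _.
  by rewrite mulrA -rmorphM/= -exprS.
apply: le_trans (normc_sum _ _ _) _.
have -> : e / (r - 1) * (q - 1) * q ^+ a * N%:R =
    \sum_(b < N) e / (r - 1) * (q - 1) * q ^+ a.
  by rewrite sumr_const card_ord mulr_natr.
apply: ler_sum => b _; apply: le_trans (NP N NN0 _ (qa b)) _.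
by rewrite normcM normc_real normc_root_stepX mulr1 ger0_norm ?exprn_ge0.
Qed.

(** * Approximation on the interval *)

(** The term [k = 0] contributes 2, so subtracting 1 leaves the truncation of [1 + 2 sum_k T_k w^-k]
    after [T_n]. *)
Definition cheb_kernel (R : realType) (n : nat) (w : R[i]) : {poly R[i]} :=
  \sum_(k < n.+1) (w ^- k *+ 2) *: chebT R k - 1.

Lemma size_cheb_kernel (R : realType) n (w : R[i]) : (size (cheb_kernel n w) <= n.+1)%N.
Proof.
rewrite (leq_trans (size_polyD _ _))// size_polyN size_poly1 geq_max andbT.
apply: (leq_trans (size_sum _ _ _)); apply/bigmax_leqP => k _.
by rewrite (leq_trans (size_scale_leq _ _))// (leq_trans (size_chebT _ _)).
Qed.

Lemma horner_cheb_kernel (R : realType) n (u w : R[i]) : u != 0 -> w != 0 ->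
  (cheb_kernel n w).[joukowski u] =
  \sum_(k < n.+1) (u / w) ^+ k + \sum_(k < n.+1) (u * w)^-1 ^+ k - 1.
Proof.
move=> u0 w0; rewrite hornerD hornerN hornerC horner_sum -big_split/=; congr (_ - _).
apply: eq_bigr => k _; rewrite hornerZ horner_chebT// !exprVn !exprMn exprVn.
by field; rewrite !expf_neq0.
Qed.

(** For [u = cis t] and [v = 1/w] this is [(1 - v^2) / (1 - 2 v cos t + v^2)], the Poisson kernel
    with complex radius [v]. *)
Definition poisson_kernel (R : realType) (u w : R[i]) : R[i] :=
  (w ^+ 2 - 1) / ((w - u) * (w - u^-1)).

Lemma geometric_tail_le (R : realType) (v : R[i]) (r : R) n : 1 < r -> normc v = r^-1 ->
  normc ((1 - v)^-1 - \sum_(k < n.+1) v ^+ k) <= (r ^+ n)^-1 / (r - 1).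
Proof.
move=> r1 nv; have r0 : 0 < r by exact: lt_trans r1.
have rV1 : r^-1 < 1 by rewrite invf_lt1.
have d : 1 - r^-1 <= normc (1 - v).
  by rewrite -nv lerBlDr -[X in X <= _](@normc1 R) -[X in normc X <= _](subrK v) normcD.
have d0 : 0 < 1 - r^-1 by rewrite subr_gt0.
have v1 : 1 - v != 0 by rewrite -normc_gt0 (lt_le_trans d0).
have -> : (1 - v)^-1 - \sum_(k < n.+1) v ^+ k = v ^+ n.+1 / (1 - v).
  apply: (mulIf v1); rewrite mulrBl mulVf// divfK//.
  by rewrite -[1 - v]opprB mulrN [_ * (v - 1)]mulrC -subrX1; ring.
rewrite normcM normcX normcV nv.
have -> : (r ^+ n)^-1 / (r - 1) = r^-1 ^+ n.+1 / (1 - r^-1).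
  have r10 : r - 1 != 0 by rewrite subr_eq0 gt_eqF.
  by rewrite exprVn exprS; field; rewrite r10 !gt_eqF// exprn_gt0.
by rewrite ler_wpM2l ?exprn_ge0 ?invr_ge0 ?(ltW r0)// lef_pV2 ?posrE// (lt_le_trans d0).
Qed.

(** By partial fractions the kernel is [1 / (1 - u/w) + 1 / (1 - 1/(u w)) - 1], so its truncation
    error consists of the tails of two geometric series with ratios of modulus [1/r]. *)
Lemma poisson_kernel_tail_le (R : realType) (t r : R) (w : R[i]) n : 1 < r -> normc w = r ->
  normc (poisson_kernel (cis t) w - (cheb_kernel n w).[joukowski (cis t)]) <=
  2 * (r ^+ n)^-1 / (r - 1).
Proof.
move=> r1 nw; have r0 : 0 < r by exact: lt_trans r1.
have u0 := cis_neq0 t; have w0 : w != 0 by rewrite -normc_gt0 nw.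
have w1 (v : R[i]) : normc v = 1 -> w - v != 0.
  move=> nv; rewrite subr_eq0; apply: contraTneq r1 => wv.
  by rewrite -nw wv nv ltxx.
have wu : w - cis t != 0 by rewrite w1// normc_cis.
have wuV : w - (cis t)^-1 != 0 by rewrite w1// -cisN normc_cis.
have uw1 : cis t * w - 1 != 0.
  apply: contra wuV; rewrite !subr_eq0 => /eqP uw.
  by rewrite -[X in _ == X]mulr1 -uw mulKf.
rewrite horner_cheb_kernel//.
have -> : poisson_kernel (cis t) w = (1 - cis t / w)^-1 + (1 - (cis t * w)^-1)^-1 - 1.
  by rewrite /poisson_kernel; field; rewrite w0 u0 uw1.
set a := (1 - _)^-1; set b := (1 - _)^-1; set c := \sum_(_ < _) _; set d := \sum_(_ < _) _.
have -> : a + b - 1 - (c + d - 1) = (a - c) + (b - d) by ring.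
apply: le_trans (normcD _ _) _.
have -> : 2 * (r ^+ n)^-1 / (r - 1) = (r ^+ n)^-1 / (r - 1) + (r ^+ n)^-1 / (r - 1) by ring.
apply: lerD; apply: geometric_tail_le => //.
  by rewrite normcM normcV normc_cis nw mul1r.
by rewrite normcV normcM normc_cis nw mul1r.
Qed.

(** A contour integral over the circle of radius [r] discretized at [N] points; each [N] already
    gives a polynomial of degree at most [n], so no limit of polynomials is formed. *)
Definition cheb_approx (R : realType) (f : R[i]^o -> R[i]^o) (r : R) (n N : nat) : {poly R[i]} :=
  \sum_(b < N) (f (joukowski (r%:C * root_step R N ^+ b)) / N%:R) *:
    cheb_kernel n (r%:C * root_step R N ^+ b).

Lemma size_cheb_approx (R : realType) (f : R[i]^o -> R[i]^o) (r : R) (n N : nat) :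
  (size (cheb_approx f r n N) <= n.+1)%N.
Proof.
apply: (leq_trans (size_sum _ _ _)); apply/bigmax_leqP => k _.
by rewrite (leq_trans (size_scale_leq _ _))// size_cheb_kernel.
Qed.

(** Truncation at [N.-1] leaves only exponents below [N], and orthogonality kills all of them but 0;
    what remains is [N + N - N]. *)
Lemma mean_cheb_kernel (R : realType) (u : R[i]) (r : R) (N : nat) :
  u != 0 -> 0 < r -> (0 < N)%N ->
  \sum_(b < N) (cheb_kernel N.-1 (r%:C * root_step R N ^+ b)).[joukowski u] = N%:R.
Proof.
move=> u0 r0 N0; have rC : r%:C != 0 :> R[i] by rewrite -normc_eq0 normc_real normr_eq0 gt_eqF.
have w0 b : r%:C * root_step R N ^+ b != 0.
  by rewrite mulf_neq0// expf_neq0// cis_neq0.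
under eq_bigr => b _ do rewrite horner_cheb_kernel// prednK//.
have pw (c : R[i]) : \sum_(b < N) \sum_(k < N) (c / (root_step R N ^+ b)) ^+ k = N%:R.
  rewrite exchange_big/= -[N in RHS](prednK N0).
  rewrite (bigD1 (Ordinal N0))//= [X in _ + X]big1 => [|k k0].
    by rewrite addr0 (eq_bigr (fun=> 1)) ?sumr_const ?card_ord ?prednK// => b _; rewrite expr0.
  under eq_bigr do rewrite exprMn.
  rewrite -mulr_sumr (sum_root_step_inv (fun v => v ^+ k))//.
  under eq_bigr do rewrite -exprM.
  rewrite sum_cisX ?mulr0// ltn_ord andbT lt0n.
  by apply: contra k0 => /eqP k0; apply/eqP/val_inj.
rewrite !sumrB big_split/= sumr_const card_ord.
have -> : \sum_(b < N) \sum_(k < N) (u / (r%:C * root_step R N ^+ b)) ^+ k = N%:R.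
  rewrite -[RHS](pw (u / r%:C)); apply: eq_bigr => b _; apply: eq_bigr => k _.
  by congr (_ ^+ _); rewrite invfM mulrA.
have -> : \sum_(b < N) \sum_(k < N) (u * (r%:C * root_step R N ^+ b))^-1 ^+ k = N%:R.
  rewrite -[RHS](pw (u * r%:C)^-1); apply: eq_bigr => b _; apply: eq_bigr => k _.
  by congr (_ ^+ _); rewrite mulrA invfM.
by rewrite addrK.
Qed.

Lemma cheb_approx_le (R : realType) (f : R[i]^o -> R[i]^o) (r M e : R) (n : nat) (x : R) :
  1 < r -> (forall w : R[i]^o, 1 <= normc w <= r -> analytic_at f (joukowski w)) ->
  (forall w : R[i]^o, normc w = r -> normc (f (joukowski w)) <= M) ->
  -1 <= x <= 1 -> 0 < e ->
  exists N0, forall N, (N0 <= N)%N ->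
    normc (f x%:C - (cheb_approx f r n N).[x%:C]) <= 2 * M / (r - 1) * (r ^+ n)^-1 + e.
Proof.
move=> r1 af fM x1 e0; have r0 : 0 < r by exact: lt_trans r1.
rewrite -(acosK x1) -joukowski_cis; move: (acos x) => t; set u := cis t.
have u0 : u != 0 := cis_neq0 t.
set X := joukowski u.
have afX : analytic_at f X by apply: af; rewrite normc_cis lexx ltW.
have [D aD] := analytic_difference_quotient afX.
(* On the unit circle [J w = X] does occur, at [w = u] and [w = 1/u]; the value [D] fills the
   removable singularity there. *)
pose g z : R[i] := if z == X then D else (f z - f X) / (z - X).
have sg (w : R[i]^o) : 1 <= normc w <= r -> @strictly_diff R[i] g (joukowski w).
  move=> w1; have [->|wX] := eqVneq (joukowski w) X; first exact: analytic_strictly_diff.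
  have sf := analytic_strictly_diff (af w w1).
  have wX0 : joukowski w - X != 0 by rewrite subr_eq0.
  have sB (c z : R[i]) := strictly_diffD (strictly_diff_id z) (strictly_diff_cst (- c) z).
  have sV := strictly_diff_comp (sB X (joukowski w)) (strictly_diffV wX0).
  apply: strictly_diff_ext (strictly_diffM (strictly_diffD sf (strictly_diff_cst (- f X) _)) sV).
  apply: (proj2 (nbhscP _ _)); exists (normc (joukowski w - X)); first by rewrite normc_gt0.
  move=> y wy; rewrite /g ifN//; apply: contraTneq wy => ->.
  by rewrite ltxx.
(* Off those points this is [(f (J w) - f X) P(w)], because
   [J w - X = (w - u) (w - 1/u) / (2 w)]. *)
pose G (w : R[i]^o) : R[i]^o := g (joukowski w) * ((w - w^-1) / 2).
have sG (w : R[i]^o) : 1 <= normc w <= r -> @strictly_diff R[i] G w.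
  move=> w1; have w0 : w != 0.
    by apply: contraTneq w1 => ->; rewrite normc0 ler10.
  have sV := strictly_diffV w0; have sI := strictly_diff_id w.
  have sH := strictly_diff_cst (2^-1 : R[i]) w.
  have sN := strictly_diffM (strictly_diff_cst (- 1 : R[i]) w) sV.
  have sJ : @strictly_diff R[i] (@joukowski R) w := strictly_diffM (strictly_diffD sI sV) sH.
  apply: strictly_diff_ext (strictly_diffM (strictly_diff_comp sJ (sg w w1))
    (strictly_diffM (strictly_diffD sI sN) sH)).
  by near=> y; rewrite /G mulN1r.
have e2 : 0 < e / 2 by rewrite divr_gt0.
have [N0 N01 NP] := discrete_cauchy r1 sG e2.
pose C := normc (f X) * (2 / (r - 1)).
have r10 : 0 < r - 1 by rewrite subr_gt0.
have C0 : 0 <= C by rewrite mulr_ge0 ?normc_ge0// divr_ge0// ltW.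
(* Chosen so that [C / r^(N-1) <= e / 2] follows from Bernoulli's inequality; [.+2] accounts for the
   exponent [N - 1]. *)
pose N1 := (Num.truncn (C / (e / 2) / (r - 1))).+2.
exists (maxn N0 N1) => N; rewrite geq_max => /andP[NN0 NN1].
have Np : (0 < N)%N by rewrite (leq_trans _ NN0)// ltnW.
have Np' : 0 < N%:R :> R by rewrite ltr0n.
have Nn0 : N%:R != 0 :> R[i] by rewrite pnatr_eq0 -lt0n.
pose w b : R[i] := r%:C * root_step R N ^+ b.
have nw b : normc (w b) = r by rewrite normcM normc_real normc_root_stepX mulr1 gtr0_norm.
have sG0 : \sum_(b < N) G (root_step R N ^+ b) = 0.
  have E : \sum_(b < N) G (root_step R N ^+ b) = - \sum_(b < N) G (root_step R N ^+ b).
    rewrite -[LHS](sum_root_step_inv G Np) -sumrN; apply: eq_bigr => b _.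
    by rewrite /G /joukowski invrK [_^-1 + _]addrC -mulrN -mulNr opprB.
  by apply/eqP; move/eqP: E; rewrite -addr_eq0 -mulr2n mulrn_eq0.
have GE b : G (w b) = (f (joukowski (w b)) - f X) * poisson_kernel u (w b).
  have w0 : w b != 0 by rewrite -normc_gt0 nw.
  have wne (v : R[i]) : normc v = 1 -> w b - v != 0.
    move=> nv; rewrite subr_eq0; apply: contraTneq r1 => wv.
    by rewrite -(nw b) wv nv ltxx.
  have wu : w b - u != 0 by rewrite wne// normc_cis.
  have wuV : w b - u^-1 != 0 by rewrite wne// -cisN normc_cis.
  have JX : joukowski (w b) - X = (w b - u) * (w b - u^-1) / (2 * w b).
    by rewrite /X /joukowski; field; rewrite u0 w0.
  have JX0 : joukowski (w b) != X.
    have n2 : (2 : R[i]) * w b != 0 by rewrite mulf_neq0// pnatr_eq0.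
    have nu : (w b - u) * (w b - u^-1) != 0 by exact: mulf_neq0.
    by rewrite -subr_eq0 JX; apply: mulf_neq0 => //; rewrite invr_eq0.
  rewrite /G /g ifN// JX /poisson_kernel; move: (f (joukowski (w b)) - f X : R[i]) => F.
  have uw1 : u * w b - 1 != 0.
    by rewrite -(mulfV u0) -mulrBr mulf_neq0.
  by field; rewrite u0 w0 wu [w b * u]mulrC uw1.
have := NP N NN0; rewrite sG0 subr0 => GN.
pose P b := poisson_kernel u (w b); pose Q m b := (cheb_kernel m (w b)).[X].
have PQ m b : normc (P b - Q m b) <= 2 * (r ^+ m)^-1 / (r - 1) by exact: poisson_kernel_tail_le.
have mean_le (F : nat -> R[i]) (c : R) : (forall b, normc (F b) <= c) ->
    normc ((\sum_(b < N) F b) / N%:R) <= c.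
  move=> Fc; rewrite normcM normcV normc_nat ler_pdivrMr//.
  apply: le_trans (normc_sum _ _ _) _.
  rewrite -[N in leRHS]card_ord mulr_natr -sumr_const; apply: ler_sum => b _; exact: Fc.
have qE : (cheb_approx f r n N).[X] = (\sum_(b < N) f (joukowski (w b)) * Q n b) / N%:R.
  rewrite horner_sum mulr_suml; apply: eq_bigr => b _.
  by rewrite hornerZ mulrAC.
have mQ : (\sum_(b < N) Q N.-1 b) / N%:R = 1.
  by rewrite mean_cheb_kernel// divff.
(* The first mean yields the main error; the mean of [G] is small by the discrete Cauchy theorem,
   and the last mean is a tail of order [N - 1]. The term [f X] itself appears because [Q N.-1] has
   mean 1. *)
have -> : f X - (cheb_approx f r n N).[X] =
    (\sum_(b < N) f (joukowski (w b)) * (P b - Q n b)) / N%:R -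
    ((\sum_(b < N) G (w b)) / N%:R + f X * ((\sum_(b < N) (P b - Q N.-1 b)) / N%:R)).
  have -> : \sum_(b < N) f (joukowski (w b)) * (P b - Q n b) =
      \sum_(b < N) f (joukowski (w b)) * P b - \sum_(b < N) f (joukowski (w b)) * Q n b.
    by rewrite -sumrB; apply: eq_bigr => b _; rewrite mulrBr.
  have -> : \sum_(b < N) G (w b) =
      \sum_(b < N) f (joukowski (w b)) * P b - f X * \sum_(b < N) P b.
    by rewrite mulr_sumr -sumrB; apply: eq_bigr => b _; rewrite GE mulrBl.
  by rewrite sumrB [(\sum_(b < N) P b - _) / _]mulrBl mQ qE; field.
apply: le_trans (normcB _ _) _; apply: lerD.
  apply: (mean_le (fun b => f (joukowski (w b)) * (P b - Q n b))) => b; rewrite normcM.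
  have -> : 2 * M / (r - 1) * (r ^+ n)^-1 = M * (2 * (r ^+ n)^-1 / (r - 1)) by ring.
  exact: (ler_pM (normc_ge0 _) (normc_ge0 _) (fM _ (nw b)) (PQ n b)).
rewrite (splitr e); apply: le_trans (normcD _ _) _; apply: lerD => //.
rewrite normcM; have h := mean_le (fun b => P b - Q N.-1 b) _ (PQ N.-1).
apply: (@le_trans _ _ (normc (f X) * (2 * (r ^+ N.-1)^-1 / (r - 1)))).
  by rewrite ler_wpM2l ?normc_ge0.
have -> : normc (f X) * (2 * (r ^+ N.-1)^-1 / (r - 1)) = C / r ^+ N.-1 by rewrite /C; ring.
rewrite ler_pdivrMr ?exprn_gt0// mulrC -ler_pdivrMr//.
have -> : r = 1 + (r - 1) by ring.
apply: le_trans (bernoulli_le _ (ltW r10)).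
apply: (@le_trans _ _ (N.-1%:R * (r - 1))); last by rewrite lerDr.
rewrite -ler_pdivrMr// ltW// (lt_le_trans (truncnS_gt _))// ler_nat.
by rewrite -ltnS prednK.
Unshelve. all: by end_near. Qed.

(** * Error of the interpolation *)

(** The function [s + 1/s] increases for [s >= 1], as the factorization of its increment shows. *)
Lemma bernstein_ellipse_joukowski (R : realType) (rho : R) (w : R[i]^o) :
  1 <= normc w < rho -> bernstein_ellipse rho (joukowski w).
Proof.
move=> /andP[w1 wr]; have nw0 : 0 < normc w by exact: lt_le_trans w1.
have r0 : 0 < rho by exact: lt_trans wr.
have w0 : w != 0 by rewrite -normc_gt0.
rewrite /bernstein_ellipse/= normc_foci_joukowski// -subr_gt0.
have -> : rho + rho^-1 - (normc w + (normc w)^-1) =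
    (rho - normc w) * (1 - (normc w * rho)^-1) by field; rewrite !gt_eqF.
rewrite mulr_gt0 ?subr_gt0// invf_lt1 ?mulr_gt0//.
by apply: (lt_le_trans (le_lt_trans w1 wr)); rewrite ler_peMl ?(ltW r0).
Qed.

Lemma closure_bernstein_ellipse_bounded (R : realType) (rho : R) z : 1 < rho ->
  closure (bernstein_ellipse rho) z -> normc z <= rho.
Proof.
move=> rho1 cz; apply/ler_addgt0Pr => e e0.
have nz : nbhs z [set y : R[i]^o | normc (z - y) < e].
  by apply: (proj2 (nbhscP z _)); exists e.
have [y [Ey zy]] := cz _ nz.
rewrite -[X in normc X](subrK y) addrC (le_trans (normcD _ _))// lerD ?(ltW zy)//.
have r0 : 0 < rho by exact: lt_trans rho1.
have rV : rho^-1 < rho by rewrite (lt_trans _ rho1)// invf_lt1.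
have : normc (y *+ 2) <= rho + rho^-1.
  apply: le_trans (ltW Ey).
  have -> : y *+ 2 = (y - 1) + (y + 1) by rewrite mulr2n; ring.
  exact: normcD.
by rewrite normcMn mulr2n; lra.
Qed.

(** A [sup] dominates its set only if that set is bounded; here this comes from compactness of the
    closed ellipse. *)
Lemma max_modulus_ge (R : realType) (rho : R) (f : R[i]^o -> R[i]^o) z : 1 < rho ->
  {within closure (bernstein_ellipse rho), continuous f} ->
  closure (bernstein_ellipse rho) z ->
  normc (f z) <= max_modulus f (closure (bernstein_ellipse rho)).
Proof.
move=> rho1 cf cz; apply: sup_upper_bound; last by exists z.
split; first by exists (normc (f z)), z.
have cK : compact (closure (bernstein_ellipse rho)).
  apply: (@closed_bounded_compact _ _ rho); first exact: closed_closure.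
  by move=> y; exact: closure_bernstein_ellipse_bounded.
have cfK := continuous_compact cf cK.
have : compact ((fun y : R[i]^o => normc y) @` (f @` closure (bernstein_ellipse rho))).
  apply: continuous_compact cfK; apply: continuous_subspaceT => y.
  by apply: (@cvg_normc R _ (nbhs y) _ id y); exact: cvg_id.
move=> /compact_bounded[B [_ BP]]; exists (B + 1) => _ [y Ky <-].
rewrite -[normc _]ger0_norm ?normc_ge0//; apply: (BP (B + 1)); first by rewrite ltrDl.
by exists (f y) => //; exists y.
Qed.

(** Circles of radius [r < rho] stay inside the region of analyticity. With denominators cleared,
    the left side is a polynomial in [r], and continuity gives the case [r = rho]. *)
Lemma polynomial_bound_limit (R : realType) (a b rho : R) n : 1 < rho ->
  (forall r, 1 < r -> r < rho -> a * (r - 1) * r ^+ n <= b) -> a * (rho - 1) * rho ^+ n <= b.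
Proof.
move=> rho1 ab; rewrite leNgt; apply/negP => lt.
pose h : {poly R} := a *: (('X - 1%:P) * 'X^n).
have hE r : h.[r] = a * (r - 1) * r ^+ n.
  by rewrite /h hornerZ hornerM hornerXn hornerXsubC mulrA.
have := @continuous_horner R h rho => /cvgrPdist_lt/(_ (h.[rho] - b)).
rewrite hE subr_gt0 => /(_ lt)/nbhs_ballP[d /= d0 dP].
pose r := Num.max ((1 + rho) / 2) (rho - d / 2).
have r1 : 1 < r by rewrite lt_max; apply/orP; left; lra.
have rr : r < rho by rewrite gt_max; apply/andP; split; lra.
have rd : rho - d / 2 <= r by rewrite le_max lexx orbT.
have := dP r; rewrite /ball/= hE => /(_ _)/=.
have -> : `|rho - r| < d by rewrite gtr0_norm ?subr_gt0//; lra.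
move=> /(_ isT); apply/negP; rewrite -leNgt.
by rewrite (le_trans _ (ler_norm _))// lerB// ab.
Qed.

(** At the perturbed nodes the interpolant differs from the approximating polynomial by at most the
    error [E] of the latter. That polynomial may depend on [x]: only its degree and its errors at
    [x] and at the nodes enter. *)
Lemma interpolation_error_le (R : realType) (rho eta s : R) (f : R[i]^o -> R[i]^o)
    (e : nat -> R) (n : nat) (p : {poly R[i]}) (x : R) :
  1 < rho -> (forall z, bernstein_ellipse rho z -> analytic_at f z) ->
  {within closure (bernstein_ellipse rho), continuous f} ->
  (0 < n)%N -> (forall j, (j <= n)%N -> `|e j| <= s) ->
  interpolates f (fun j => cos (j%:R * pi / n%:R + e j)) n p ->
  n%:R * s * (ln n%:R + 1) <= eta -> 0 < eta < (1 + 2 / pi)^-1 -> -1 <= x <= 1 ->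
  normc (f x%:C - p.[x%:C]) <=
  (1 + (1 + 2 / pi) / (1 - (1 + 2 / pi) * eta) * ln (expR 1 * n%:R)) *
    (2 * max_modulus f (closure (bernstein_ellipse rho)) / (rho - 1)) * rho ^- n.
Proof.
move=> rho1 af cf n0 es [sp pn] nseta /andP[eta0 eta1] x1.
set M := max_modulus _ _; set c := 1 + 2 / pi.
have c0 : 0 < c by rewrite addr_gt0// divr_gt0// pi_gt0.
have ceta : 0 < 1 - c * eta.
  by rewrite subr_gt0 mulrC -ltr_pdivlMr// mul1r.
have n0' : 0 < n%:R :> R by rewrite ltr0n.
have ln0 : 0 <= ln n%:R :> R by rewrite ln_ge0// ler1n.
have -> : ln (expR 1 * n%:R) = 1 + ln n%:R :> R.
  by rewrite lnM ?posrE ?expR_gt0// expRK.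
set K := 1 + c / (1 - c * eta) * (1 + ln n%:R).
have K0 : 0 < K.
  have cc := ltW (divr_gt0 c0 ceta).
  by rewrite ltr_wpDr// mulr_ge0// addr_ge0.
(* The smallness hypothesis bounds the denominator of [perturbed_lebesgue_le] below, independently
   of [n]. *)
have den : 1 - c * eta <= 1 - n%:R * s * (c * (1 + ln n%:R)).
  by rewrite lerD2l lerN2 mulrCA ler_pM2l// [1 + _]addrC.
(* The slack [d] pays for the finite [N]; it is removed first, for fixed [r], and then [r] tends to
   [rho]. *)
have step (r d : R) : 1 < r -> r < rho -> 0 < d ->
    normc (f x%:C - p.[x%:C]) <= K * (2 * M / (r - 1) * (r ^+ n)^-1 + d).
  move=> r1 rr d0; set E := _ + d.
  have afJ (w : R[i]^o) : 1 <= normc w <= r -> analytic_at f (joukowski w).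
    move=> /andP[w1 wr]; apply/af/bernstein_ellipse_joukowski.
    by rewrite w1 (le_lt_trans wr).
  have fM (w : R[i]^o) : normc w = r -> normc (f (joukowski w)) <= M.
    move=> wr; apply: max_modulus_ge => //; apply/subset_closure/bernstein_ellipse_joukowski.
    by rewrite wr (ltW r1).
  have approx y : -1 <= y <= 1 -> exists N0, forall N, (N0 <= N)%N ->
      normc (f y%:C - (cheb_approx f r n N).[y%:C]) <= E.
    by move=> y1; exact: cheb_approx_le.
  have [Nx NxP] := approx x x1.
  have /choice[Nj NjP] : forall j, exists N0, forall N, (N0 <= N)%N ->
      normc (f (cos (j%:R * pi / n%:R + e j))%:C -
        (cheb_approx f r n N).[(cos (j%:R * pi / n%:R + e j))%:C]) <= E.
    by move=> j; apply: approx; rewrite cos_geN1 cos_le1.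
  (* One [N] serves [x] and all [n + 1] nodes at once. *)
  pose N := maxn Nx (\max_(j < n.+1) Nj j).
  pose q := cheb_approx f r n N.
  have spq : (size (p - q)%R <= n.+1)%N.
    by rewrite (leq_trans (size_polyD _ _))// geq_max sp size_polyN size_cheb_approx.
  have fx : normc (f x%:C - q.[x%:C]) <= E by apply: NxP; rewrite leq_maxl.
  have E0 : 0 <= E by apply: le_trans fx; exact: normc_ge0.
  have pq j : (j <= n)%N -> normc (p - q).[(cos (j%:R * pi / n%:R + e j))%:C] <= E.
    move=> jn; rewrite hornerD hornerN pn//; apply: NjP.
    by rewrite leq_max (leq_bigmax (Ordinal (jn : (j < n.+1)%N))) orbT.
  have sL1 : n%:R * s * (c * (1 + ln n%:R)) < 1.
    by rewrite -subr_gt0 (lt_le_trans ceta).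
  have h := perturbed_lebesgue_le n0 spq es sL1 pq x1.
  have -> : f x%:C - p.[x%:C] = (f x%:C - q.[x%:C]) - (p - q).[x%:C].
    by rewrite hornerD hornerN opprB addrA subrK.
  apply: le_trans (normcB _ _) _; rewrite /K mulrDl mul1r; apply: lerD => //.
  apply: (le_trans h).
  have -> : c / (1 - c * eta) * (1 + ln n%:R) * E = c * (1 + ln n%:R) * E / (1 - c * eta) by ring.
  have num0 : 0 <= c * (1 + ln n%:R) * E.
    by apply: mulr_ge0 => //; apply: mulr_ge0 (ltW c0) _; rewrite addr_ge0.
  by rewrite ler_wpM2l// lef_pV2 ?posrE// (lt_le_trans _ den).
set a := normc _ in step *.
have lim : a * (rho - 1) * rho ^+ n <= K * (2 * M).
  apply: polynomial_bound_limit => // r r1 rr.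
  have r0 : 0 < r ^+ n by rewrite exprn_gt0// (lt_trans _ r1).
  have r10 : 0 < r - 1 by rewrite subr_gt0.
  rewrite -ler_pdivlMr// -ler_pdivlMr//.
  have -> : K * (2 * M) / r ^+ n / (r - 1) = K * (2 * M / (r - 1) * (r ^+ n)^-1) by ring.
  apply/ler_addgt0Pr => d d0; apply: le_trans (step r (d / K) r1 rr (divr_gt0 d0 K0)) _.
  by rewrite mulrDr [K * (d / K)]mulrC divfK// gt_eqF.
have rho0 : 0 < rho ^+ n by rewrite exprn_gt0// (lt_trans _ rho1).
have rho10 : 0 < rho - 1 by rewrite subr_gt0.
rewrite -ler_pdivlMr// -ler_pdivlMr// in lim.
by apply: (le_trans lim); rewrite le_eqVlt; apply/orP; left; apply/eqP; ring.
Qed.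

(** * Essential supremum and uniform convergence *)

Lemma Linf_norm_le (R : realType) (g : R -> R[i]^o) (B : R) : 0 <= B ->
  (forall x, -1 <= x <= 1 -> normc (g x) <= B) -> (Linf_norm g <= B%:E)%E.
Proof.
(* On a space of measure 0 the norm is set to 0, whence [B0]. Otherwise the exceptional null set is
   the complement of [[-1, 1]]. *)
move=> B0 gB; rewrite /Linf_norm unlock; case: ifP => _; last by rewrite lee_fin.
apply/ess_supP; exists (~` `[-1, 1]%classic); split.
- exact: measurableC.
- by rewrite -[LHS]/(lebesgue_measure (~` `[-1, 1]%classic `&` `[-1, 1]%classic)) setICl measure0.
by move=> x /= + x1; apply; rewrite lee_fin ger0_norm ?normc_ge0// gB.
Qed.

(** Split [rho = s^2]. One factor [s^n] absorbs the logarithm through [ln n <= n] and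
    [n (s - 1) <= s^n]; the other still tends to infinity, by Bernoulli's inequality. *)
Lemma geometric_log_small (R : realType) (rho C K d : R) : 1 < rho -> 0 <= C -> 0 < d ->
  exists N, forall n, (N <= n)%N -> (0 < n)%N ->
    (1 + C * ln (expR 1 * n%:R)) * K * rho ^- n < d.
Proof.
move=> rho1 C0 d0; pose s := Num.sqrt rho.
have s1 : 1 < s by rewrite -sqrtr1 ltr_sqrt// (lt_trans _ rho1).
have rhoE : rho = s * s by rewrite -expr2 sqr_sqrtr// ltW// (lt_trans _ rho1).
have s0 : 0 < s by exact: lt_trans s1.
have h0 : 0 < s - 1 by rewrite subr_gt0.
pose A := 1 + C + C / (s - 1).
have A0 : 0 <= A by rewrite !addr_ge0// divr_ge0// ltW.
exists (Num.truncn (A * `|K| / d / (s - 1))).+1 => n Nn n0.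
have n0' : 0 < n%:R :> R by rewrite ltr0n.
have -> : ln (expR 1 * n%:R) = 1 + ln n%:R :> R.
  by rewrite lnM ?posrE ?expR_gt0// expRK.
have sn : 1 + n%:R * (s - 1) <= s ^+ n.
  by apply: le_trans (bernoulli_le n (ltW h0)) _; rewrite addrC subrK.
have sn0 : 0 < s ^+ n by exact: exprn_gt0.
have ln0 : 0 <= ln n%:R :> R by rewrite ln_ge0// ler1n.
have le1 : 1 + C * (1 + ln n%:R) <= A * s ^+ n.
  have ln1 : C * ln n%:R <= C / (s - 1) * s ^+ n.
    rewrite -mulrA ler_wpM2l// mulrC ler_pdivlMr//.
    apply: (@le_trans _ _ (n%:R * (s - 1))); first by rewrite ler_wpM2r ?ltW// ln_sublinear.
    by apply: le_trans sn; rewrite lerDr.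
  have c1 : 1 + C <= (1 + C) * s ^+ n by rewrite ler_peMr ?addr_ge0// exprn_ege1// ltW.
  by rewrite /A [leRHS]mulrDl mulrDr mulr1 addrA lerD.
apply: (@le_lt_trans _ _ (A * s ^+ n * `|K| * rho ^- n)).
  rewrite ler_wpM2r ?invr_ge0 ?exprn_ge0 ?(ltW (lt_trans _ rho1))//.
  apply: (@le_trans _ _ ((1 + C * (1 + ln n%:R)) * `|K|)); last by rewrite ler_wpM2r.
  by rewrite ler_wpM2l ?ler_norm// addr_ge0// mulr_ge0// addr_ge0.
have -> : A * s ^+ n * `|K| * rho ^- n = A * `|K| / s ^+ n.
  by rewrite rhoE exprMn; field; rewrite gt_eqF.
rewrite ltr_pdivrMr// [ltRHS]mulrC -ltr_pdivrMr//.
apply: (@lt_le_trans _ _ (n%:R * (s - 1))).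
  by rewrite -ltr_pdivrMr// (lt_le_trans (truncnS_gt _))// ler_nat.
by apply: le_trans sn; rewrite lerDr.
Qed.

Theorem corollary4p1 (R : realType) (rho : R) (f : R[i]^o -> R[i]^o)
    (eps : nat -> nat -> R) (sigma : nat -> R) (eta : R) (I_eps : nat -> {poly R[i]}) :
  let M := max_modulus f (closure (bernstein_ellipse rho)) in
  let C_eta := (1 + 2 / pi) / (1 - (1 + 2 / pi) * eta) in
  1 < rho ->
  (forall z, bernstein_ellipse rho z -> analytic_at f z) ->
  {within closure (bernstein_ellipse rho), continuous f} ->
  (forall n, (1 <= n)%N ->
    [/\ forall i j, (i <= n)%N -> (j <= n)%N -> i != j ->
          perturbed_node eps n i != perturbed_node eps n j,
        forall j, (j <= n)%N -> `|eps n j| <= sigma n,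
        eps n 0%N = 0 & eps n n = 0]) ->
  (forall n, (1 <= n)%N -> interpolates f (perturbed_node eps n) n (I_eps n)) ->
  (forall n, (1 <= n)%N -> n%:R * sigma n * (ln n%:R + 1) <= eta) ->
  0 < eta < (1 + 2 / pi)^-1 ->
  (forall n, (1 <= n)%N ->
    (Linf_norm (fun x : R => f x%:C - (I_eps n).[x%:C])%R <=
      ((1 + C_eta * ln (expR 1 * n%:R)) * (2 * M / (rho - 1)) * rho ^- n)%:E)%E) /\
  {uniform `[-1, 1],
     (fun n (x : R) => (I_eps n).[x%:C] : R[i]^o) @ \oo --> (fun x : R => f x%:C)}.
Proof.
move=> M C_eta rho1 af cf nodes interp nseta eta1.
have bound n x : (1 <= n)%N -> -1 <= x <= 1 -> normc (f x%:C - (I_eps n).[x%:C]) <=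
    (1 + C_eta * ln (expR 1 * n%:R)) * (2 * M / (rho - 1)) * rho ^- n.
  move=> n1 x1; have [_ es _ _] := nodes n n1.
  exact: (interpolation_error_le rho1 af cf n1 es (interp n n1) (nseta n n1) eta1 x1).
have zero1 : -1 <= (0 : R) <= 1 by rewrite lerN10 ler01.
split=> [n n1|].
  apply: Linf_norm_le => [|x x1]; last exact: bound.
  (* The pointwise bound at [x = 0] shows that the right-hand side is nonnegative. *)
  exact: le_trans (normc_ge0 _) (bound n 0 n1 zero1).
have [c0 ceta] : 0 < 1 + 2 / pi :> R /\ 0 < 1 - (1 + 2 / pi) * eta.
  have c0 : 0 < 1 + 2 / pi :> R by rewrite addr_gt0// divr_gt0// pi_gt0.
  by split=> //; case/andP: eta1 => _ ltV; rewrite subr_gt0 [ltLHS]mulrC -ltr_pdivlMr// mul1r.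
have C0 : 0 <= C_eta by rewrite divr_ge0// ltW.
move=> P /uniform_nbhs[E [entE EP]].
(* The radius of a ball in [R[i]] is complex; positivity forces its imaginary part to vanish. *)
move: entE; rewrite -entourage_ballE => -[[d d'] /=]; rewrite ltcE/= => /andP[/eqP -> d0] dE.
have [N NP] := geometric_log_small (2 * M / (rho - 1)) rho1 C0 d0.
(* The maximum with 1 excludes [n = 0], for which nothing is assumed about [I_eps]. *)
exists (maxn N 1) => // n /=; rewrite geq_max => /andP[Nn n1]; apply: EP => x /=.
rewrite in_itv/= => x1; apply: dE => /=; rewrite -ball_normE/= norm_normc ltcR.
exact: le_lt_trans (bound n x n1 x1) (NP n Nn n1).
Qed.
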